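(* Let $g:\mathbb{R}^n\to\mathbb{R}\cup\{\infty\}$ be a proper, lower semicontinuous, convex function and $(\bar x,\bar v)\in\operatorname{gph}\partial g$. Then $$\operatorname{par}\partial g^*(\bar v)\subseteq\ker\partial^2g(\bar x\mid\bar v)\cup\bigl(-\ker\partial^2g(\bar x\mid\bar v)\bigr).$$ If $g^*$ is twice epi-differentiable at $\bar v$, then $$\operatorname{par}\partial g^*(\bar v)\subseteq\ker\partial^2g(\bar x\mid\bar v).$$ Moreover, if $g^*$ is $\mathcal{C}^2$-cone reducible at $\bar v$, then equality holds: $$\operatorname{par}\partial g^*(\bar v)=\ker\partial^2g(\bar x\mid\bar v).$$
   Context: $g^*(y)=\sup_x\{\langle x,y\rangle-g(x)\}$ is the Fenchel conjugate and $\partial$ the convex subdifferential. For a convex set $C$, $\operatorname{par}C=\operatorname{span}(C-x)$ for any $x\in C$ (subspace parallel to $C$). Regular normal cone: $\hat N_\Omega(\bar z)=\{v\mid\langle v,z-\bar z\rangle\le o(\|z-\bar z\|)\ \forall z\in\Omega\}$; limiting normal cone $N_\Omega(\bar z)$: limits of $v_k\in\hat N_\Omega(z_k)$ with $z_k\to\bar z$, $z_k\in\Omega$. Generalized Hessian of $g$ at $(\bar x,\bar v)\in\operatorname{gph}\partial g$: the set-valued map $\partial^2g(\bar x\mid\bar v)(u)=D^*(\partial g)(\bar x\mid\bar v)(u)=\{v\mid(v,-u)\in N_{\operatorname{gph}\partial g}(\bar x,\bar v)\}$. Its kernel is $\ker\partial^2g(\bar x\mid\bar v)=\{w\mid0\in\partial^2g(\bar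 x\mid\bar v)(w)\}$. Twice epi-differentiability: for $f:\mathbb{R}^n\to\overline{\mathbb{R}}$ finite at $\bar u$, let $\Delta_t^2f(\bar u\mid\bar z)(w)=\bigl(f(\bar u+tw)-f(\bar u)-t\langle\bar z,w\rangle\bigr)/(\tfrac12t^2)$ for $t>0$, and $d^2f(\bar u\mid\bar z)(w)=\liminf_{\tau\downarrow0,\,w'\to w}\Delta^2_\tau f(\bar u\mid\bar z)(w')$. $f$ is twice epi-differentiable at $\bar u$ for $\bar z$ if for every $w$ and every sequence $t_k\downarrow0$ there exist $w_k\to w$ with $\Delta^2_{t_k}f(\bar u\mid\bar z)(w_k)\to d^2f(\bar u\mid\bar z)(w)$; it is twice epi-differentiable at $\bar u$ if this holds for every $\bar z\in\partial f(\bar u)$. $\mathcal{C}^2$-cone reducibility: a closed convex set $\Theta\subseteq\mathbb{R}^m$ is $\mathcal{C}^2$-cone reducible at $\bar z\in\Theta$ if there exist a neighborhood $V$ of $\bar z$, a pointed ($K\cap(-K)=\{0\}$) closed convex cone $K\subseteq\mathbb{R}^\ell$ and a $\mathcal{C}^2$ map $h:V\to\mathbb{R}^\ell$ with $h(\bar z)=0$, $Dh(\bar z)$ surjective, and $\Theta\cap V=\{z\in V\mid h(z)\in K\}$. A closed, proper, convex function $f$ is $\mathcal{C}^2$-cone reducible at $\bar u\in\operatorname{dom}f$ if its epigraph $\operatorname{epi}f$ is $\mathcal{C}^2$-cone reducible at $(\bar u,f(\bar u))$. *)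

(* Defs.v *)
From HB Require Import structures.
From mathcomp Require Export all_boot all_order all_algebra.
From mathcomp Require Export all_classical all_reals all_analysis.
Export numFieldNormedType.Exports.

Set Implicit Arguments.
Unset Strict Implicit.
Unset Printing Implicit Defensive.

Import Order.TTheory GRing.Theory Num.Theory.

Local Open Scope classical_set_scope.
Local Open Scope ring_scope.

(* R^n is 'rV[R]_n, whose library norm is the max norm.  The norm is only used
   in little-o conditions and through the topology, so this is equivalent to
   using the Euclidean norm. *)

Section Convex.
Context {R : realType} {n : nat}.
Implicit Types (x y z u v w : 'rV[R]_n) (f g : 'rV[R]_n -> \bar R).

Definition inner x y : R := \sum_(i < n) x 0 i * y 0 i.

Definition proper_fun f :=
  (forall x, (-oo < f x)%E) /\ (exists x, (f x < +oo)%E).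

(* Meant for functions that avoid -oo, so that the right-hand side is never
   of the form +oo - oo. *)
Definition convex_efun f := forall x y (t : R), 0 < t -> t < 1 ->
  (f (t *: x + (1 - t) *: y)%R <= t%:E * f x + (1 - t)%:E * f y)%E.

Definition fenchel g : 'rV[R]_n -> \bar R :=
  fun y => ereal_sup [set ((inner x y)%:E - g x)%E | x in [set: 'rV[R]_n]].

Definition subdiff f x : set 'rV[R]_n :=
  [set v | f x \is a fin_num /\
           forall y, (f x + (inner v (y - x)%R)%:E <= f y)%E].

Definition lin_span (A : set 'rV[R]_n) : set 'rV[R]_n :=
  [set w | exists2 X : seq 'rV[R]_n,
             (forall x, x \in X -> A x) & w \in <<X>>%VS].

(* The span does not depend on the base point x of C; par set0 is empty. *)
Definition par (C : set 'rV[R]_n) : set 'rV[R]_n :=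
  [set w | exists2 x, C x & lin_span [set y - x | y in C] w].

End Convex.

Section NormalCones.
Context {R : realType} {m : nat}.
Implicit Types (Omega : set 'rV[R]_m) (z v : 'rV[R]_m).

Definition regular_normal_cone Omega z : set 'rV[R]_m :=
  [set v | Omega z /\ forall e : R, 0 < e ->
     \forall y \near nbhs z, Omega y -> inner v (y - z) <= e * `|y - z|].

Definition limiting_normal_cone Omega z : set 'rV[R]_m :=
  [set v | exists zk vk : nat -> 'rV[R]_m,
     [/\ forall k, Omega (zk k) /\ regular_normal_cone Omega (zk k) (vk k),
         zk @ \oo --> z & vk @ \oo --> v]].

End NormalCones.

Section GeneralizedHessian.
Context {R : realType} {n : nat}.
Implicit Types (g : 'rV[R]_n -> \bar R) (x v u w : 'rV[R]_n).

Definition gph_subdiff g : set 'rV[R]_(n + n) :=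
  [set z | subdiff g (lsubmx z) (rsubmx z)].

Definition gen_hessian g x v u : set 'rV[R]_n :=
  [set w | limiting_normal_cone (gph_subdiff g) (row_mx x v) (row_mx w (- u))].

Definition ker_gen_hessian g x v : set 'rV[R]_n :=
  [set w | gen_hessian g x v w 0].

End GeneralizedHessian.

Section TwiceEpiDifferentiability.
Context {R : realType} {n : nat}.
Implicit Types (f : 'rV[R]_n -> \bar R) (u z w : 'rV[R]_n) (t : R).

(* f u is finite wherever this is used, so the subtractions are harmless. *)
Definition second_quotient f u z t w : \bar R :=
  ((f (u + t *: w)%R - f u - (t * inner z w)%:E) * ((2^-1 * t ^+ 2)^-1)%:E)%E.

Definition second_subderivative f u z w : \bar R :=
  limf_einf (fun p : R * 'rV[R]_n => second_quotient f u z p.1 p.2)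
            (filter_prod (0 : R)^'+ (nbhs w)).

Definition twice_epi_diff_for f u z :=
  f u \is a fin_num /\
  forall w (t : nat -> R), (forall k, 0 < t k) -> t @ \oo --> 0 ->
    exists wk : nat -> 'rV[R]_n, wk @ \oo --> w /\
      (fun k => second_quotient f u z (t k) (wk k)) @ \oo -->
        second_subderivative f u z w.

Definition twice_epi_diff f u :=
  f u \is a fin_num /\ forall z, subdiff f u z -> twice_epi_diff_for f u z.

End TwiceEpiDifferentiability.

Section ConeReducibility.
Context {R : realType}.

(* Meant for open V: the directional derivatives are then determined by the
   restriction of h to V. *)
Definition C2_on m l (V : set 'rV[R]_m) (h : 'rV[R]_m -> 'rV[R]_l) :=
  forall x, V x -> differentiable h x /\
    forall a : 'rV[R]_m, differentiable ('D_a h) x /\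
      forall b : 'rV[R]_m, {for x, continuous ('D_b ('D_a h))}.

Definition pointed_closed_convex_cone l (K : set 'rV[R]_l) :=
  [/\ closed K, convex_set K,
      forall (t : R) y, 0 <= t -> K y -> K (t *: y)
    & K `&` [set - y | y in K] = [set 0]].

Definition C2_cone_reducible_set m (Theta : set 'rV[R]_m) (z : 'rV[R]_m) :=
  [/\ closed Theta, convex_set Theta, Theta z
    & exists (V : set 'rV[R]_m) (l : nat) (K : set 'rV[R]_l)
             (h : 'rV[R]_m -> 'rV[R]_l),
      [/\ open V /\ V z, pointed_closed_convex_cone K, C2_on V h,
          h z = 0 /\ (forall y, exists x, 'd h z x = y)
        & Theta `&` V = [set x | V x /\ K (h x)]]].

Definition epi n (f : 'rV[R]_n -> \bar R) : set 'rV[R]_(n + 1) :=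
  [set z | (f (lsubmx z) <= (rsubmx z 0 0)%:E)%E].

Definition C2_cone_reducible n (f : 'rV[R]_n -> \bar R) (u : 'rV[R]_n) :=
  f u \is a fin_num /\
  C2_cone_reducible_set (epi f) (row_mx u (const_mx (fine (f u)))).

End ConeReducibility.

(* Main.v *)
Require Import Defs.
From mathcomp Require Import all_boot all_order all_algebra.
From mathcomp Require Import all_classical all_reals all_analysis.
From mathcomp Require Import ring lra.

(** Write f for the conjugate of g, and C for the subdifferential of f at
    vbar.  Since g is closed, proper and convex, a pair (x, v) lies on the
    graph of the subdifferential of g if and only if x is a subgradient of f
    at v (subdiff_fenchel, by separating a point from the epigraph of g).  A
    vector w is in the kernel of the generalized Hessian when (0, - w) is a
    limiting normal to that graph at (xbar, vbar).

    The first two claims follow from par C being contained in the kernel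
    (par_sub_ker), which is a consequence of monotonicity.  If both x and
    x + delta w belong to C, then every point (x', v') of the graph satisfies
    inner (v' - vbar) (x' - x - delta w) >= 0.  Hence inner w (v' - vbar) is at
    most a multiple of |v' - vbar| |x' - x|, which is quadratic in the distance
    from (x', v') to (x, vbar), and (0, w) is a regular normal at (x, vbar).
    By convexity every element of par C has the form s (a - b) with a, b in C
    (par_conic_diff).  The points x of the segment from xbar towards a leave
    room for a small step in the direction b - a, and they converge to xbar;
    so (0, - s (a - b)) is a limiting normal at (xbar, vbar).

    For the converse inclusion, suppose that near z0 = (vbar, f vbar) the
    epigraph of f is the set where h has values in the pointed cone K, and let
    J z be the Jacobian matrix of h at z, acting on rows.  The argument
    produces enough motions inside the graph.

    - Normals of the epigraph at z near z0 are the vectors lam *m (J z)^T with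
      lam normal to K at h z, and lam is bounded in terms of the normal
      (normal_cone_pullback, multiplier).  This rests on the openness of h with
      a linear rate around z0, a form of the inverse function theorem obtained
      from a contraction (linear_openness).
    - Let zeta be in the kernel of J z0, and let z be a point of the epigraph
      near z0.  Openness corrects z + t zeta, up to an error that is a small
      multiple of t, to a point z' with h z' = h z.  The same multiplier lam
      then gives a normal at z', and it differs from the normal at z by O(t)
      because J is Lipschitz (normal_transport).  After normalisation, this
      moves a subgradient pair (x, v) to a pair (x', v') with
      v' - v = t d + small and x' - x = O(t), where d is the first component
      of zeta (subdiff_transport).
    - Testing regular normals close to (0, - w) against these motions and
      passing to the limit gives inner w d >= 0, because the component of the
      normal that meets x' - x tends to 0 (limiting_normal_transport).  The
      same holds for - d, so inner w d = 0.
    - If d is orthogonal to all differences of points of C, then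
      zeta = (d, inner xbar d) is orthogonal to all normals of the epigraph at
      z0.  Were zeta *m J z0 outside K, separation would give a normal with
      positive inner product with zeta; so both zeta *m J z0 and its opposite
      lie in K, and zeta *m J z0 = 0 since K is pointed (subdiff_polar_ker).

    Thus w is orthogonal to every d that is orthogonal to par C, which puts w
    in par C (par_dual). *)

Set Implicit Arguments.
Unset Strict Implicit.
Unset Printing Implicit Defensive.

Import Order.TTheory GRing.Theory Num.Theory.

Local Open Scope classical_set_scope.
Local Open Scope ring_scope.

(** * Inner product and norm estimates *)

Section InnerAndNorm.
Context {R : realType}.

Lemma innerC n (x y : 'rV[R]_n) : inner x y = inner y x.
Proof. by apply: eq_bigr => i _; rewrite mulrC. Qed.

Lemma innerDl n (x y z : 'rV[R]_n) : inner (x + y) z = inner x z + inner y z.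
Proof. by rewrite -big_split; apply: eq_bigr => i _; rewrite mxE mulrDl. Qed.

Lemma innerZl n (a : R) (x y : 'rV[R]_n) : inner (a *: x) y = a * inner x y.
Proof. by rewrite mulr_sumr; apply: eq_bigr => i _; rewrite mxE mulrA. Qed.

Lemma innerNl n (x y : 'rV[R]_n) : inner (- x) y = - inner x y.
Proof. by rewrite -scaleN1r innerZl mulN1r. Qed.

Lemma innerBl n (x y z : 'rV[R]_n) : inner (x - y) z = inner x z - inner y z.
Proof. by rewrite innerDl innerNl. Qed.

Lemma innerDr n (x y z : 'rV[R]_n) : inner x (y + z) = inner x y + inner x z.
Proof. by rewrite innerC innerDl !(innerC x). Qed.

Lemma innerZr n (a : R) (x y : 'rV[R]_n) : inner x (a *: y) = a * inner x y.
Proof. by rewrite innerC innerZl innerC. Qed.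

Lemma innerNr n (x y : 'rV[R]_n) : inner x (- y) = - inner x y.
Proof. by rewrite innerC innerNl innerC. Qed.

Lemma innerBr n (x y z : 'rV[R]_n) : inner x (y - z) = inner x y - inner x z.
Proof. by rewrite innerDr innerNr. Qed.

Lemma inner0l n (x : 'rV[R]_n) : inner 0 x = 0.
Proof. by rewrite -(scale0r 0) innerZl mul0r. Qed.

Lemma inner0r n (x : 'rV[R]_n) : inner x 0 = 0.
Proof. by rewrite innerC inner0l. Qed.

Definition innerE := (innerDl, innerDr, innerNl, innerNr, innerZl, innerZr,
  inner0l, inner0r).

Lemma inner_row_mx m n (a c : 'rV[R]_m) (b d : 'rV[R]_n) :
  inner (row_mx a b) (row_mx c d) = inner a c + inner b d.
Proof.
rewrite /inner big_split_ord; congr (_ + _); apply: eq_bigr => i _;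
  by rewrite ?row_mxEl ?row_mxEr.
Qed.

Lemma inner_ge0 n (x : 'rV[R]_n) : 0 <= inner x x.
Proof. by apply: sumr_ge0 => i _; rewrite -expr2 sqr_ge0. Qed.

Lemma inner_gt0 n (x : 'rV[R]_n) : x != 0 -> 0 < inner x x.
Proof.
move=> x0; rewrite lt_neqAle inner_ge0 andbT eq_sym; apply: contra x0.
rewrite psumr_eq0 => [|i _]; last by rewrite -expr2 sqr_ge0.
move=> /allP x0; apply/eqP/rowP => i; rewrite mxE; apply/eqP.
by have := x0 i (mem_index_enum _); rewrite /= -expr2 sqrf_eq0.
Qed.

Lemma norm_entry_le m n (M : 'M[R]_(m, n)) i j : `|M i j| <= `|M|.
Proof.
rewrite [leRHS]/Num.Def.normr /= mx_normrE.
exact: (le_bigmax _ (fun ij : 'I_m * 'I_n => `|M ij.1 ij.2|) (i, j)).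
Qed.

Lemma norm_le_entries m n (M : 'M[R]_(m, n)) (c : R) :
  0 <= c -> (forall i j, `|M i j| <= c) -> `|M| <= c.
Proof.
move=> c0 Mc; rewrite [leLHS]/Num.Def.normr /= mx_normrE.
by apply/bigmax_leP; split => // -[i j] _; exact: Mc.
Qed.

Lemma norm_mulmx_le m n p (M : 'M[R]_(m, n)) (N : 'M[R]_(n, p)) :
  `|M *m N| <= n%:R * (`|M| * `|N|).
Proof.
apply: norm_le_entries => [|i j]; first by rewrite !mulr_ge0.
rewrite mxE (le_trans (ler_norm_sum _ _ _))//.
apply: (@le_trans _ _ (\sum_(k < n) (`|M| * `|N|))).
  by apply: ler_sum => k _; rewrite normrM ler_pM// norm_entry_le.
by rewrite sumr_const card_ord mulr_natl.
Qed.

Lemma norm_inner_le n (x y : 'rV[R]_n) : `|inner x y| <= n%:R * (`|x| * `|y|).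
Proof.
rewrite (le_trans (ler_norm_sum _ _ _))//.
apply: (@le_trans _ _ (\sum_(k < n) (`|x| * `|y|))).
  by apply: ler_sum => k _; rewrite normrM ler_pM// norm_entry_le.
by rewrite sumr_const card_ord mulr_natl.
Qed.

Lemma inner_le n (x y : 'rV[R]_n) : inner x y <= n%:R * (`|x| * `|y|).
Proof. exact: le_trans (ler_norm _) (norm_inner_le _ _). Qed.

Lemma norm_lsubmx_le m n (z : 'rV[R]_(m + n)) : `|lsubmx z| <= `|z|.
Proof.
by apply: norm_le_entries => // i j; rewrite mxE norm_entry_le.
Qed.

Lemma norm_rsubmx_le m n (z : 'rV[R]_(m + n)) : `|rsubmx z| <= `|z|.
Proof.
by apply: norm_le_entries => // i j; rewrite mxE norm_entry_le.
Qed.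

Lemma norm_row_mx_le m n (a : 'rV[R]_m) (b : 'rV[R]_n) :
  `|row_mx a b| <= `|a| + `|b|.
Proof.
apply: norm_le_entries => [|i j]; first by rewrite addr_ge0.
rewrite mxE; case: splitP => k _.
  by rewrite (le_trans (norm_entry_le _ _ _))// lerDl.
by rewrite (le_trans (norm_entry_le _ _ _))// lerDr.
Qed.

Lemma near_dist_lt (V : normedModType R) (x : V) (r : R) :
  0 < r -> \forall y \near x, `|y - x| < r.
Proof.
move=> r0; have := nbhsx_ballx x r r0.
by rewrite -ball_normE; apply: filterS => y /=; rewrite distrC.
Qed.

Lemma near_dist (V : normedModType R) (x : V) (P : set V) :
  (\forall y \near x, P y) -> exists2 r : R, 0 < r & forall y, `|y - x| < r -> P y.
Proof.
move=> /nbhs_ballP[r /= r0 rP]; exists r => // y yx.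
by apply: rP; rewrite -ball_normE /= distrC.
Qed.

End InnerAndNorm.

(** * Projection on closed convex sets and separation *)

Section Separation.
Context {R : realType}.

Lemma convex_setP m (S : set 'rV[R]_m) : convex_set S ->
  forall x y (t : R), 0 <= t -> t <= 1 -> S x -> S y ->
    S (t *: x + (1 - t) *: y).
Proof.
move=> cS x y t t0 t1 Sx Sy.
by have := cS x y (Itv01 t0 t1) (mem_set Sx) (mem_set Sy); move/set_mem.
Qed.

Lemma continuous_sqdist m (p : 'rV[R]_m) :
  continuous (fun s : 'rV[R]_m => inner (s - p) (s - p)).
Proof.
move=> s; apply/(@cvgrPdist_le _ _ _ (nbhs s) (nbhs_filter s)) => e e0.
set c := 1 + m%:R * (1 + 2 * `|s - p|).
have c0 : 0 < c by rewrite ltr_wpDr// mulr_ge0// addr_ge0// mulr_ge0.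
have d0 : 0 < Num.min 1 (c^-1 * e) by rewrite lt_min ltr01/= mulr_gt0// invr_gt0.
apply: filterS (near_dist_lt s d0) => y; rewrite lt_min => /andP[ys1].
rewrite ltr_pdivlMl// => /ltW; apply: le_trans.
rewrite distrC (_ : _ - _ = inner (y - s) ((y - s) + 2 *: (s - p))); last first.
  by rewrite !innerE (innerC p y) (innerC s y) (innerC p s); ring.
rewrite (le_trans (norm_inner_le _ _))// mulrCA mulrC ler_wpM2r//.
rewrite /c (@le_trans _ _ (m%:R * (1 + 2 * `|s - p|))) ?lerDr//.
rewrite ler_wpM2l// (le_trans (ler_normD _ _))// normrZ gtr0_norm//.
by rewrite lerD2r ltW.
Qed.

(** Any point of S cuts out a compact part of S on which the squared distance
    has a minimum. *)
Lemma closest_point m (S : set 'rV[R]_m) (p : 'rV[R]_m) :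
  closed S -> S !=set0 -> exists2 q, S q &
    forall s, S s -> inner (q - p) (q - p) <= inner (s - p) (s - p).
Proof.
move=> cS [s0 Ss0]; pose r := inner (s0 - p) (s0 - p).
pose A := S `&` [set s | inner (s - p) (s - p) <= r].
have cA : compact A.
  apply: bounded_closed_compact.
    exists (1 + r + `|p|); split=> [|M rM s [_ /= sr]]; first exact: num_real.
    have r0 : 0 <= r := inner_ge0 _.
    apply: le_trans (ltW rM); apply: norm_le_entries.
      by rewrite !addr_ge0.
    move=> i j; rewrite -[s](subrK p) mxE (le_trans (ler_normD _ _))//.
    rewrite lerD ?norm_entry_le// ord1.
    have : (s - p) 0 j ^+ 2 <= r.
      apply: le_trans sr; rewrite /inner (bigD1 j)//= expr2 lerDl.
      by apply: sumr_ge0 => k _; rewrite -expr2 sqr_ge0.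
    rewrite -real_normK ?num_real//; move: (normr_ge0 ((s - p) 0 j)); nra.
  apply: closedI => //.
  have := @preimage_closed _ R (fun s : 'rV[R]_m => inner (s - p) (s - p))
    [set x | x <= r]; apply => [x _|]; first exact: continuous_sqdist.
  exact: closed_le.
have [||q qA qmin] := @EVT_min_rV R m (fun s => inner (s - p) (s - p)) A _ cA.
- by exists s0; split => //=.
- exact/continuous_subspaceT/continuous_sqdist.
move/set_mem: qA => [Sq qr]; exists q => // s Ss.
have [sr|/ltW rs] := leP (inner (s - p) (s - p)) r.
  by apply: qmin; apply/mem_set; split.
exact: le_trans qr rs.
Qed.

(** First-order optimality of the projection q of p, along segments of S. *)
Lemma closest_point_obtuse m (S : set 'rV[R]_m) (p q : 'rV[R]_m) :
  convex_set S -> S q ->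
  (forall s, S s -> inner (q - p) (q - p) <= inner (s - p) (s - p)) ->
  forall s, S s -> inner (p - q) (s - q) <= 0.
Proof.
move=> cS Sq qmin s Ss; rewrite leNgt; apply/negP => gt0.
set a := inner (p - q) (s - q) in gt0; set b := inner (s - q) (s - q).
have b0 : 0 <= b := inner_ge0 _.
(* moving from q towards s by t changes the squared distance by
   t (t b - 2 a), which is negative for the t below *)
pose t := a / (a + b).
have ab0 : 0 < a + b by rewrite ltr_pwDl.
have tE : t * (a + b) = a by rewrite /t divfK// gt_eqF.
have t0 : 0 < t by rewrite divr_gt0.
have t1 : t <= 1 by rewrite ler_pdivrMr// mul1r lerDl.
have := qmin _ (convex_setP cS (ltW t0) t1 Ss Sq).
have -> : t *: s + (1 - t) *: q - p = t *: (s - q) - (p - q).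
  by apply/rowP => i; rewrite !mxE; ring.
have -> : inner (t *: (s - q) - (p - q)) (t *: (s - q) - (p - q)) =
    t ^+ 2 * b - 2 * t * a + inner (q - p) (q - p).
  rewrite -(opprB p q) /a /b; move: (p - q) (s - q) => u v.
  by rewrite !innerE (innerC v u); ring.
by rewrite leNgt => /negP; apply; nra.
Qed.

(** The normal p - q at the projection q separates, with the gap
    inner (p - q) (p - q). *)
Lemma separation m (S : set 'rV[R]_m) (p : 'rV[R]_m) :
  closed S -> convex_set S -> S !=set0 -> ~ S p ->
  exists (a : 'rV[R]_m) (c : R), 0 < c /\
    forall s, S s -> inner a s <= inner a p - c.
Proof.
move=> clS cS S0 Sp; have [q Sq qmin] := closest_point p clS S0.
exists (p - q), (inner (p - q) (p - q)); split.
  by apply: inner_gt0; rewrite subr_eq0; apply: contra_notN Sp => /eqP ->.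
move=> s Ss; have := closest_point_obtuse cS Sq qmin Ss.
by rewrite -innerBr subKr innerBr subr_le0.
Qed.

(** On a cone, a linear form bounded above is nonpositive. *)
Lemma cone_separation m (K : set 'rV[R]_m) (p : 'rV[R]_m) :
  closed K -> convex_set K -> K !=set0 ->
  (forall (t : R) y, 0 <= t -> K y -> K (t *: y)) -> ~ K p ->
  exists2 a : 'rV[R]_m, 0 < inner a p & forall y, K y -> inner a y <= 0.
Proof.
move=> clK cK K0 coneK Kp; have [a [c [c0 sep]]] := separation clK cK K0 Kp.
have ap : 0 < inner a p.
  case: K0 => y Ky; have := sep _ (coneK 0 _ (lexx 0) Ky).
  by rewrite scale0r inner0r subr_ge0 => /(lt_le_trans c0).
exists a => // y Ky; rewrite leNgt; apply/negP => ay.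
have := sep _ (coneK (inner a p / inner a y) _ (ltW (divr_gt0 ap ay)) Ky).
by rewrite innerZr divfK ?gt_eqF// lerBrDr gerDl leNgt c0.
Qed.

Lemma closed_of_dist m (S : set 'rV[R]_m) :
  (forall z, ~ S z -> exists2 r : R, 0 < r & forall y, `|y - z| < r -> ~ S y) ->
  closed S.
Proof.
move=> SC; rewrite -(setCK S); apply: open_closedC; rewrite openE => z /SC[r r0 rS].
by apply: filterS (near_dist_lt z r0) => y /rS.
Qed.

End Separation.

(** * Epigraphs and the inversion of subdifferentials by conjugation *)

Section Epigraph.
Context {R : realType} {n : nat}.
Implicit Types (f g : 'rV[R]_n -> \bar R) (x v y : 'rV[R]_n).

Lemma epi_row_mx f x (a : R) : epi f (row_mx x (const_mx a)) <-> (f x <= a%:E)%E.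
Proof. by rewrite /epi /= row_mxKl row_mxKr mxE; split. Qed.

Lemma row_mx_epi (z : 'rV[R]_(n + 1)) :
  z = row_mx (lsubmx z) (const_mx (rsubmx z 0 0)).
Proof.
rewrite -[LHS]hsubmxK; congr row_mx.
by apply/rowP => i; rewrite !mxE !ord1.
Qed.

Lemma inner_const_mx1 (a b : R) :
  inner (const_mx a : 'rV[R]_1) (const_mx b) = a * b.
Proof. by rewrite /inner big_ord1 !mxE. Qed.

(** A level b strictly between the height of z and the value of f stays below
    f near z, by lower semicontinuity. *)
Lemma closed_epi f : lower_semicontinuous f -> closed (epi f).
Proof.
move=> lscf; apply: closed_of_dist => z /negP; rewrite -ltNge => zf.
have [b zb bf] : exists2 b, rsubmx z 0 0 < b & (b%:E < f (lsubmx z))%E.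
  case: (f _) zf => [r| |//].
    rewrite lte_fin => zr; exists ((rsubmx z 0 0 + r) / 2); last rewrite lte_fin.
      by lra.
    by lra.
  by exists (rsubmx z 0 0 + 1); rewrite ?ltry// ltrDl.
have [V /near_dist[r r0 rV] Vb] := lscf _ _ bf.
exists (Num.min r (b - rsubmx z 0 0)); first by rewrite lt_min r0 subr_gt0.
move=> y; rewrite lt_min => /andP[yr yb] /=; apply/negP; rewrite -ltNge.
apply: (@lt_trans _ _ b%:E); last first.
  by apply/Vb/rV; rewrite -linearB (le_lt_trans (norm_lsubmx_le _)).
rewrite lte_fin -(ltrD2r (- rsubmx z 0 0)); apply: le_lt_trans yb.
apply: le_trans (norm_entry_le (y - z) 0 (rshift n 0)).
by rewrite (le_trans _ (ler_norm _))// !mxE.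
Qed.

Lemma convex_epi f : convex_efun f -> convex_set (epi f).
Proof.
move=> cf; apply/convex_setW => z y /set_mem ez /set_mem ey k k0 k1.
apply/mem_set; rewrite /epi /= !linearD !linearZ /=.
apply: (le_trans (cf _ _ _ k0 k1)); rewrite !mxE.
move: ez ey; rewrite /epi /= !mxE => ez ey; rewrite [leRHS]EFinD.
by apply: leeD; rewrite EFinM; apply: lee_wpmul2l => //; rewrite lee_fin ?subr_ge0 ltW.
Qed.

End Epigraph.

Section FenchelYoung.
Context {R : realType} {n : nat}.
Implicit Types (f g : 'rV[R]_n -> \bar R) (x v y : 'rV[R]_n).

Lemma fenchel_ge g x y : ((inner x y)%:E - g x <= fenchel g y)%E.
Proof. by apply: ereal_sup_ubound; exists x. Qed.

(** Bounding the conjugate through points of the epigraph avoids the infinite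
    values of g. *)
Lemma fenchel_le_epi g y (c : R) :
  (forall x (a : R), (g x <= a%:E)%E -> inner x y - a <= c) ->
  (fenchel g y <= c%:E)%E.
Proof.
move=> gc; apply: ge_ereal_sup => _ [x _ <-].
case gx : (g x) => [r| |]; last 2 first.
- by rewrite /= leNye.
- have := gc x (inner x y - c - 1); rewrite gx leNye => /(_ erefl).
  by rewrite leNgt => /negP[]; lra.
- by rewrite -EFinB lee_fin; apply: gc; rewrite gx.
Qed.

Lemma subdiff_fenchel_of g x v : subdiff g x v -> subdiff (fenchel g) v x.
Proof.
move=> [gx sub]; have [r gxr] : exists r, g x = r%:E by move/fineK: gx => <-; eexists.
have fv : fenchel g v = (inner x v - r)%:E.
  apply/eqP; rewrite eq_le; apply/andP; split.
    apply: fenchel_le_epi => y a ya; have := le_trans (sub y) ya.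
    by rewrite gxr -EFinD lee_fin !innerE (innerC v y) (innerC v x); lra.
  by apply: le_trans (fenchel_ge _ x v); rewrite gxr.
split; first by rewrite fv.
move=> y; apply: le_trans (fenchel_ge _ x y); rewrite fv gxr -EFinB -EFinD lee_fin.
by rewrite !innerE; lra.
Qed.

(** The subgradient x of the conjugate at v forces equality in the
    Fenchel-Young inequality at x and v.  Otherwise the point of height
    inner x v - r over x, with r the value of the conjugate at v, lies strictly
    below the graph of g, and a hyperplane separating it from the epigraph
    yields a dual point where the conjugate violates the subgradient
    inequality. *)
Lemma subdiff_of_fenchel g x v :
  proper_fun g -> lower_semicontinuous g -> convex_efun g ->
  subdiff (fenchel g) v x -> subdiff g x v.
Proof.
move=> [gNy [x0 x0y]] lscg cg [fv sub].
have [r fvr] : exists r, fenchel g v = r%:E by move/fineK: fv => <-; eexists.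
have ge y : ((inner y v - r)%:E <= g y)%E.
  have := fenchel_ge g y v; rewrite fvr; move: (gNy y).
  by case: (g y) => [s| |]//= _; rewrite ?leey// -EFinB !lee_fin; lra.
suff gx : (g x <= (inner x v - r)%:E)%E.
  have gxE : g x = (inner x v - r)%:E by apply/eqP; rewrite eq_le gx ge.
  split=> [|y]; first by rewrite gxE.
  apply: le_trans (ge y); rewrite gxE -EFinD lee_fin !innerE.
  by rewrite (innerC v x) (innerC v y); lra.
apply: contrapT => /(epi_row_mx g x (inner x v - r)) xepi.
have [r0 x0E] : exists r0, g x0 = r0%:E.
  by exists (fine (g x0)); rewrite fineK// fin_numE gt_eqF// lt_eqF.
have [|a [c [c0 sep]]] := separation (closed_epi lscg) (convex_epi cg) _ xepi.
  by exists (row_mx x0 (const_mx r0)); apply/epi_row_mx; rewrite x0E.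
have sepE y b : (g y <= b%:E)%E -> inner (lsubmx a) y + rsubmx a 0 0 * b <=
    inner (lsubmx a) x + rsubmx a 0 0 * (inner x v - r) - c.
  move=> /epi_row_mx/sep; rewrite [a in inner a]row_mx_epi !inner_row_mx.
  by rewrite !inner_const_mx1.
move: (lsubmx a) (rsubmx a 0 0) sepE => {sep} p s sepE.
have s0 : s <= 0.
  rewrite leNgt; apply/negP => s0.
  set d := inner p x + s * (inner x v - r) - c - inner p x0 - s * r0.
  have := sepE x0 (r0 + (`|d| + 1) / s); rewrite x0E lee_fin.
  rewrite lerDl divr_ge0 ?addr_ge0 ?(ltW s0)// => /(_ erefl).
  rewrite mulrDr mulrCA divff ?gt_eqF// mulr1.
  by have := ler_norm d; rewrite /d; lra.
(* for a horizontal separating direction p, the conjugate grows along p more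
   slowly than the subgradient x requires; otherwise p / - s is the slope of
   an affine minorant of g, and the conjugate is too small there *)
have [s0'|sn0] := eqVneq s 0.
  have := sub (v + p); rewrite fvr leNgt => /negP; apply.
  apply: (@le_lt_trans _ _ (r + (inner p x - c))%:E).
    apply: fenchel_le_epi => y b yb; have := le_trans (ge y) yb.
    by rewrite lee_fin innerDr; have := sepE y b yb; rewrite s0' (innerC y p); lra.
  by rewrite -EFinD lte_fin addrAC subrr add0r (innerC x); lra.
have sN : 0 < - s by rewrite oppr_gt0 lt_neqAle sn0.
have := sub ((- s)^-1 *: p); rewrite fvr leNgt => /negP; apply.
apply: (@le_lt_trans _ _ ((- s)^-1 * (inner p x + s * (inner x v - r) - c))%:E).
  apply: fenchel_le_epi => y b yb.
  rewrite innerZr -(ler_pM2l sN) mulrBr !mulrA divff ?gt_eqF// !mul1r.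
  by rewrite (innerC y); have := sepE y b yb; lra.
rewrite -EFinD lte_fin innerBr innerZr (innerC x p).
rewrite mulrBr mulrDr mulrA invrN !mulNr mulVf// mul1r.
have : 0 < (- s)^-1 * c by rewrite mulr_gt0 ?invr_gt0.
by rewrite invrN; lra.
Qed.

Lemma subdiff_fenchel g x v :
  proper_fun g -> lower_semicontinuous g -> convex_efun g ->
  subdiff (fenchel g) v x <-> subdiff g x v.
Proof.
by move=> pg lg cg; split; [exact: subdiff_of_fenchel|exact: subdiff_fenchel_of].
Qed.

Lemma subdiff_monotone g x v y w : subdiff g x v -> subdiff g y w ->
  0 <= inner (v - w) (x - y).
Proof.
move=> [gx sx] [gy sy]; move: (sx y) (sy x); move/fineK: gx => <-; move/fineK: gy => <-.
by rewrite -!EFinD !lee_fin !innerE; lra.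
Qed.

End FenchelYoung.

(** * The parallel subspace of a convex set *)

Section ParallelSubspace.
Context {R : realType} {n : nat}.
Implicit Types (C : set 'rV[R]_n) (x y z a b w d : 'rV[R]_n).

Lemma subdiff_convex (f : 'rV[R]_n -> \bar R) u x y (t : R) :
  0 <= t -> t <= 1 -> subdiff f u x -> subdiff f u y ->
  subdiff f u (t *: x + (1 - t) *: y).
Proof.
move=> t0 t1 [fu sx] [_ sy]; split=> // z; move: (sx z) (sy z).
move/fineK: fu => <-; rewrite -!EFinD.
case: (f z) => [r| |]; rewrite ?leey ?leeNy_eq//.
rewrite !lee_fin !innerDl !innerZl => hx hy.
by nra.
Qed.

Lemma conic_diff_add C :
  (forall x y (t : R), 0 <= t -> t <= 1 -> C x -> C y ->
     C (t *: x + (1 - t) *: y)) ->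
  forall (s t : R) a b x y, 0 <= s -> 0 <= t -> C a -> C b -> C x -> C y ->
  exists (r : R) c d, [/\ 0 <= r, C c, C d &
    s *: (a - b) + t *: (x - y) = r *: (c - d)].
Proof.
move=> cC s t a b x y s0 t0 Ca Cb Cx Cy.
have [st0|st] := eqVneq (s + t) 0.
  have [-> ->] : s = 0 /\ t = 0 by lra.
  by exists 0, a, b; rewrite !scale0r addr0.
have st_gt0 : 0 < s + t by rewrite lt_neqAle eq_sym st addr_ge0.
have k0 : 0 <= s / (s + t) by rewrite divr_ge0// ltW.
have k1 : s / (s + t) <= 1 by rewrite ler_pdivrMr// mul1r lerDl.
exists (s + t), (s / (s + t) *: a + (1 - s / (s + t)) *: x),
  (s / (s + t) *: b + (1 - s / (s + t)) *: y).
split; [exact: ltW|exact: cC|exact: cC|].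
by apply/rowP => i; rewrite !mxE; field.
Qed.

(** The vectors s (a - b) with s >= 0 and a, b in C form a subspace when C is
    convex, by conic_diff_add and by exchanging a and b. *)
Lemma par_conic_diff C :
  (forall x y (t : R), 0 <= t -> t <= 1 -> C x -> C y ->
     C (t *: x + (1 - t) *: y)) ->
  forall w, par C w ->
  exists (r : R) a b, [/\ 0 <= r, C a, C b & w = r *: (a - b)].
Proof.
move=> cC w [x Cx [X + wX]]; elim: X w wX => [|y X IH] w.
  by rewrite span_nil memv0 => /eqP -> _; exists 0, x, x; rewrite scale0r.
rewrite span_cons => /memv_addP[u /vlineP[k ->] [v vX ->]] XC.
have [||t [c [d [t0 Cc Cd ->]]]] := IH v; rewrite // ?inE//.
  by move=> z zX; apply: XC; rewrite inE zX orbT.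
have [|z Cz <-] := XC y; first by rewrite mem_head.
have [k0|/ltW k0] := leP 0 k; first exact: conic_diff_add.
have -> : k *: (z - x) = (- k) *: (x - z) by rewrite scaleNr -scalerN opprB.
by apply: conic_diff_add => //; rewrite oppr_ge0.
Qed.

End ParallelSubspace.

(** * The parallel subspace lies in the kernel *)

Section ParInKernel.
Context {R : realType} {n : nat} (g : 'rV[R]_n -> \bar R).
Implicit Types (x v w a b : 'rV[R]_n).

(** Monotonicity against the point (x + delta w, v) bounds inner w (v' - v) by
    inner (v' - v) (x' - x) / delta, a quantity of second order. *)
Lemma regular_normal_segment x v w (delta : R) : 0 < delta ->
  subdiff g x v -> subdiff g (x + delta *: w) v ->
  regular_normal_cone (gph_subdiff g) (row_mx x v) (row_mx 0 w).
Proof.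
move=> d0 gx gw; split=> [|e e0]; first by rewrite /gph_subdiff /= row_mxKl row_mxKr.
pose c := n%:R / delta + 1.
have c0 : 0 < c by rewrite ltr_wpDl// divr_ge0// ltW.
have ec0 : 0 < e / c by rewrite divr_gt0.
apply: filterS (near_dist_lt (row_mx x v) ec0) => y; rewrite ltr_pdivlMr// => ye gy.
have mon := subdiff_monotone gy gw.
set z := y - row_mx x v in ye *.
have zl : lsubmx y - x = lsubmx z by rewrite linearB /= row_mxKl.
have zr : rsubmx y - v = rsubmx z by rewrite linearB /= row_mxKr.
rewrite -[z in inner _ z]hsubmxK inner_row_mx inner0l add0r.
move: mon; rewrite zr opprD addrA zl innerBr innerZr subr_ge0 => mon.
have zz : inner (rsubmx z) (lsubmx z) <= n%:R * (`|z| * `|z|).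
  apply: le_trans (inner_le _ _) _; apply: ler_wpM2l => //.
  by apply: ler_pM; rewrite ?norm_rsubmx_le ?norm_lsubmx_le.
rewrite innerC -(ler_pM2l d0) (le_trans mon)// (le_trans zz)//.
rewrite mulrA (mulrA delta) ler_wpM2r//.
have : delta * (`|z| * c) <= delta * e by rewrite ler_wpM2l// ltW.
apply: le_trans; rewrite /c mulrCA mulrDr mulr1 mulrCA divff ?gt_eqF// mulr1.
by rewrite mulrC ler_wpM2l// lerDl ltW.
Qed.

(** At the points x + t (a - x) with 0 < t <= 1, a step in the direction b - a
    stays in the subdifferential of the conjugate; as t tends to 0 their
    regular normals become limiting normals at (x, v). *)
Lemma par_sub_ker x v : proper_fun g -> lower_semicontinuous g -> convex_efun g ->
  subdiff g x v -> par (subdiff (fenchel g) v) `<=` ker_gen_hessian g x v.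
Proof.
move=> pg lg cg gxv w parw.
have dualP y : subdiff (fenchel g) v y <-> subdiff g y v by exact: subdiff_fenchel.
have cC := @subdiff_convex R n (fenchel g) v.
have [s [a [b [s0 Ca Cb wE]]]] := par_conic_diff cC parw.
have Cx : subdiff (fenchel g) v x by apply/dualP.
pose t (k : nat) : R := harmonic k.
have t0 k : 0 < t k by exact: harmonic_gt0.
have t1 k : t k <= 1 by rewrite /t /= invf_le1// ler1n.
exists (fun k => row_mx x v + t k *: row_mx (a - x) 0), (fun=> row_mx 0 (- w)).
have zE k : row_mx x v + t k *: row_mx (a - x) 0 = row_mx (t k *: a + (1 - t k) *: x) v.
  rewrite scale_row_mx add_row_mx scaler0 addr0; congr row_mx.
  by apply/rowP => i; rewrite !mxE; ring.
split=> [k| |]; last 1 first.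
- exact: cvg_cst.
- have Cxk : subdiff (fenchel g) v (t k *: a + (1 - t k) *: x).
    by apply: cC => //; exact: ltW.
  suff reg : regular_normal_cone (gph_subdiff g)
      (row_mx (t k *: a + (1 - t k) *: x) v) (row_mx 0 (- w)).
    by rewrite zE; split => //; case: reg.
  (* the step is short enough for the end point to stay in the segment hull
     of a, b and x, whatever the factor s *)
  have s1 : 0 < s + 1 by rewrite ltr_wpDl.
  apply: (@regular_normal_segment _ _ _ (t k / (s + 1))); first by rewrite divr_gt0.
    exact/dualP.
  apply/dualP; set r := s / (s + 1).
  have -> : t k *: a + (1 - t k) *: x + (t k / (s + 1)) *: - w =
      t k *: (r *: b + (1 - r) *: a) + (1 - t k) *: x.
    by apply/rowP => i; rewrite wE /r !mxE; field; rewrite gt_eqF.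
  apply: (cC) => //; first exact: ltW.
  by apply: cC => //; rewrite /r ?divr_ge0 ?ler_pdivrMr ?mul1r ?lerDl// ltW.
rewrite -[X in _ --> X]addr0 -(scale0r (row_mx (a - x) 0)).
by apply: cvgD; [exact: cvg_cst|apply: cvgZr_tmp; exact: cvg_harmonic].
Qed.

End ParInKernel.

(** * Strict differentiability and linear openness of maps of class C^1 *)

Lemma entryB (R : realType) m n (A B : 'M[R]_(m, n)) i j :
  (A - B) i j = A i j - B i j.
Proof. by rewrite !mxE. Qed.

Lemma continuous_near (R : realType) (V W : normedModType R) (F : V -> W) z0 :
  {for z0, continuous F} ->
  forall e : R, 0 < e -> \forall z \near z0, `|F z - F z0| <= e.
Proof.
move=> /cvgrPdist_le cF e e0; apply: filterS (cF e e0) => z.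
by rewrite distrC.
Qed.

Section StrictDifferentiability.
Context {R : realType} {m l : nat}.
Implicit Types (F : 'rV[R]_m -> 'rV[R]_l) (z a : 'rV[R]_m).

Lemma jacobianE F z i j : differentiable F z ->
  ('J F z) i j = ('D_(delta_mx 0 i) F z) 0 j.
Proof. by move=> dF; rewrite deriveE// mxE. Qed.

(** Only finitely many directional derivatives are involved, so their
    continuity at z0 makes the whole Jacobian matrix continuous there. *)
Lemma jacobian_near F z0 : (\forall z \near z0, differentiable F z) ->
  (forall a, {for z0, continuous ('D_a F)}) ->
  forall e : R, 0 < e -> exists2 r : R, 0 < r & forall z, `|z - z0| < r ->
    (forall a, is_derive z a F (a *m 'J F z)) /\ `|'J F z - 'J F z0| <= e.
Proof.
move=> /near_dist[r1 r1_gt0 dF] cF e e0.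
have De i : \forall z \near z0,
    `|'D_(delta_mx 0 i) F z - 'D_(delta_mx 0 i) F z0| <= e.
  exact: (continuous_near (cF (delta_mx 0 i)) e0).
have [r2 r2_gt0 {}De] := near_dist (@filter_forall _ 'I_m _ _ (nbhs_filter z0) De).
exists (Num.min r1 r2); first by rewrite lt_min r1_gt0.
move=> z; rewrite lt_min => /andP[/dF dFz /De Dez].
have dFz0 : differentiable F z0 by apply: dF; rewrite subrr normr0.
split=> [a|].
  by split; [exact: diff_derivable|rewrite deriveEjacobian].
apply: norm_le_entries => [|i j]; first exact: ltW.
have E : ('J F z - 'J F z0) i j =
    ('D_(delta_mx 0 i) F z - 'D_(delta_mx 0 i) F z0) 0 j.
  rewrite [LHS]entryB [RHS]entryB; congr (_ - _); exact: jacobianE.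
by rewrite E; apply: le_trans (norm_entry_le _ _ _) (Dez i).
Qed.

Lemma is_derive_line F z a (df : 'rV[R]_l) j (s : R) :
  is_derive (z + s *: a) a F df ->
  is_derive s 1 (fun s : R => F (z + s *: a) 0 j) (df 0 j).
Proof.
move=> [dF dfE]; pose G (s : R) := F (z + s *: a).
have quot : (fun h : R => h^-1 *: ((G \o shift s) (h *: 1) - G s)) =
    (fun h => h^-1 *: ((F \o shift (z + s *: a)) (h *: a) - F (z + s *: a))).
  apply/funext => h; rewrite /G /=; congr (_ *: (F _ - _)).
  by rewrite [h%:A]mulr1 scalerDl addrCA.
have dG : derivable G s 1 by rewrite /derivable quot.
split; first by move/derivable_mxP : dG; exact.
have := derive_mx dG; rewrite {1}/derive quot -/(derive F (z + s *: a) a) dfE.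
by move=> ->; rewrite mxE.
Qed.

(** The mean value theorem along the segment from z2 to z1, one coordinate of F
    at a time. *)
Lemma strict_differentiability F z0 : (\forall z \near z0, differentiable F z) ->
  (forall a, {for z0, continuous ('D_a F)}) ->
  forall e : R, 0 < e -> exists2 r : R, 0 < r & forall z1 z2,
    `|z1 - z0| < r -> `|z2 - z0| < r ->
    `|F z1 - F z2 - (z1 - z2) *m 'J F z0| <= e * `|z1 - z2|.
Proof.
move=> dF cF e e0.
have em0 : 0 < e / (m%:R + 1) by rewrite divr_gt0// ltr_wpDl.
have [r r0] := jacobian_near dF cF em0.
move: (jacobian F) => J rP; exists r => // z1 z2 z1r z2r.
set a := z1 - z2.
have seg (s : R) : 0 <= s -> s <= 1 -> `|z2 + s *: a - z0| < r.
  move=> s0 s1; have -> : z2 + s *: a - z0 = s *: (z1 - z0) + (1 - s) *: (z2 - z0).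
    by apply/rowP => i; rewrite !mxE; ring.
  rewrite (le_lt_trans (ler_normD _ _))// !normrZ !ger0_norm ?subr_ge0//.
  have [->|sn0] := eqVneq s 0; first by rewrite mul0r add0r subr0 mul1r.
  have : s * `|z1 - z0| < s * r by rewrite ltr_pM2l// lt_neqAle eq_sym sn0.
  have : (1 - s) * `|z2 - z0| <= (1 - s) * r by rewrite ler_wpM2l ?subr_ge0// ltW.
  by lra.
apply: norm_le_entries => [|i j]; first by rewrite mulr_ge0// ltW.
rewrite ord1.
pose phi : R -> R := fun s => F (z2 + s *: a) 0 j.
have dphi (s : R) : 0 <= s -> s <= 1 ->
    is_derive s 1 phi ((a *m J (z2 + s *: a)) 0 j).
  by move=> s0 s1; have [dJ _] := rP _ (seg _ s0 s1); exact: is_derive_line (dJ a).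
have [s||s /[!in_itv]/= /andP[s0 s1]] :=
    @MVT_segment R phi (fun s => (a *m J (z2 + s *: a)) 0 j) 0 1 ler01.
- by rewrite in_itv/= => /andP[/ltW s0 /ltW s1]; exact: dphi.
- apply: continuous_in_subspaceT => s /[!inE]/=; rewrite in_itv/= => /andP[s0 s1].
  apply: differentiable_continuous; apply/derivable1_diffP.
  by have [] := dphi s s0 s1.
rewrite /phi scale1r scale0r addr0 subr0 mulr1 [z2 + a]addrC subrK => E.
rewrite !entryB E -entryB -mulmxBr.
apply: (le_trans (norm_entry_le _ _ _)); apply: (le_trans (norm_mulmx_le _ _)).
have [_ Je] := rP _ (seg _ s0 s1).
have : m%:R * (`|a| * `|J (z2 + s *: a) - J z0|) <=
       m%:R * (`|a| * (e / (m%:R + 1))) by rewrite !ler_wpM2l.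
move=> /le_trans; apply; rewrite mulrCA [leRHS]mulrC ler_wpM2l//.
rewrite mulrCA ler_piMr//; first exact: ltW.
by rewrite ler_pdivrMr ?ltr_wpDl// mul1r lerDl.
Qed.

Lemma locally_lipschitz F z0 : (\forall z \near z0, differentiable F z) ->
  (forall a, {for z0, continuous ('D_a F)}) ->
  exists (c r : R), [/\ 0 < c, 0 < r & forall z1 z2,
    `|z1 - z0| < r -> `|z2 - z0| < r -> `|F z1 - F z2| <= c * `|z1 - z2|].
Proof.
move=> dF cF; have [r r0 rP] := strict_differentiability dF cF ltr01.
exists (1 + m%:R * `|'J F z0|), r; split; [|exact: r0|move=> z1 z2 z1r z2r].
  by rewrite ltr_wpDr// mulr_ge0.
rewrite -[F z1 - F z2](subrK ((z1 - z2) *m 'J F z0)).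
rewrite (le_trans (ler_normD _ _))// mulrDl lerD ?rP//.
by rewrite (le_trans (norm_mulmx_le _ _))// -mulrA (mulrC `|z1 - z2|).
Qed.

End StrictDifferentiability.

Section LinearOpenness.
Context {R : realType}.

(** The displacement |Phi b - b| has a minimum on the compact set A, and
    applying Phi multiplies it by at most q < 1; so the minimum is 0. *)
Lemma contraction_fixpoint l (A : set 'rV[R]_l) (Phi : 'rV[R]_l -> 'rV[R]_l) (q : R) :
  compact A -> A !=set0 -> 0 <= q -> q < 1 -> (forall b, A b -> A (Phi b)) ->
  (forall b c, A b -> A c -> `|Phi b - Phi c| <= q * `|b - c|) ->
  exists2 b, A b & Phi b = b.
Proof.
move=> cA A0 q0 q1 PA PL.
have [|b /set_mem Ab bmin] := @EVT_min_rV R l (fun b => `|Phi b - b|) A A0 cA.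
  apply/subspace_continuousP => b Ab; apply/cvgrPdist_le => e e0.
  have e2 : 0 < e / 2 by rewrite divr_gt0.
  apply: filterS (near_dist_lt b e2) => c cb Ac.
  rewrite (le_trans (ler_dist_dist _ _))//.
  have -> : Phi b - b - (Phi c - c) = Phi b - Phi c - (b - c).
    by apply/rowP => i; rewrite !mxE; ring.
  rewrite (le_trans (ler_normB _ _))//; have := PL _ _ Ab Ac.
  rewrite distrC in cb; have : q * `|b - c| <= 1 * `|b - c| by rewrite ler_wpM2r// ltW.
  by lra.
exists b => //; apply/eqP; rewrite -subr_eq0 -normr_eq0.
have := bmin _ (mem_set (PA _ Ab)); have := PL _ _ (PA _ Ab) Ab.
move: (normr_ge0 (Phi b - b)); set u := `|Phi b - b|; set v := `|_ - _| => u0 h1 h2.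
have : (1 - q) * u <= 0 by lra.
rewrite pmulr_rle0 ?subr_gt0// => u1; apply/eqP; lra.
Qed.

(** A point z' with h z' = y is sought as z + b *m B, so that to first
    order h moves by b.  By strict differentiability, the map
    b |-> b + (y - h (z + b *m B)) is a contraction of ratio 1/2 near 0; it
    preserves the ball of radius 2 |y - h z|, and its fixed point is a
    solution.  The constants do not depend on z. *)
Lemma linear_openness m l (h : 'rV[R]_m -> 'rV[R]_l) z0 (B : 'M[R]_(l, m)) :
  (\forall z \near z0, differentiable h z) ->
  (forall a, {for z0, continuous ('D_a h)}) -> B *m 'J h z0 = 1%:M ->
  exists (c r : R), [/\ 0 < c, 0 < r & forall z y, `|z - z0| < r ->
    `|y - h z| < r -> exists2 z', h z' = y & `|z' - z| <= c * `|y - h z|].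
Proof.
move=> dh ch BJ; pose c := l%:R * `|B| + 1.
have c0 : 0 < c by rewrite ltr_wpDl// mulr_ge0.
have Bc (b : 'rV[R]_l) : `|b *m B| <= c * `|b|.
  rewrite (le_trans (norm_mulmx_le _ _))// [`|b| * _]mulrC mulrA ler_wpM2r//.
  by rewrite lerDl.
have e0 : 0 < (2 * c)^-1 by rewrite invr_gt0 mulr_gt0.
have [r r0 rP] := strict_differentiability dh ch e0.
exists (2 * c), (r / (1 + 2 * c)); split; [lra| |move=> z y zr yr].
  by rewrite divr_gt0// ltr_pwDl// mulr_ge0// ltW.
have cc : 0 < 1 + 2 * c by lra.
set rho := `|y - h z| in yr *.
have inr (b : 'rV[R]_l) : `|b| <= 2 * rho -> `|z + b *m B - z0| < r.
  move=> brho; rewrite addrAC (le_lt_trans (ler_normD _ _))//.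
  have := Bc b; have : c * `|b| <= c * (2 * rho) by rewrite ler_wpM2l// ltW.
  move: zr yr; rewrite !ltr_pdivlMr//; set u := `|z - z0|; nra.
pose Phi (b : 'rV[R]_l) := b + (y - h (z + b *m B)).
have PhiL b b' : `|b| <= 2 * rho -> `|b'| <= 2 * rho ->
    `|Phi b - Phi b'| <= 2^-1 * `|b - b'|.
  move=> br b'r; have := rP _ _ (inr _ br) (inr _ b'r).
  have -> : z + b *m B - (z + b' *m B) = (b - b') *m B.
    by rewrite mulmxBl opprD addrACA subrr add0r.
  rewrite -mulmxA BJ mulmx1 -normrN => H.
  have -> : Phi b - Phi b' = - (h (z + b *m B) - h (z + b' *m B) - (b - b')).
    by rewrite /Phi; apply/rowP => i; rewrite !mxE; ring.
  apply: le_trans H _; rewrite ler_pdivrMl ?mulr_gt0//.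
  by have := Bc (b - b'); lra.
have Phi0 : Phi 0 = y - h z by rewrite /Phi mul0mx addr0 add0r.
have rho0 : 0 <= rho by exact: normr_ge0.
have n0 : `|0 : 'rV[R]_l| <= 2 * rho by rewrite normr0 mulr_ge0.
have [||||b|b b' /= br b'r|b /= br bP] :=
    @contraction_fixpoint l [set b | `|b| <= 2 * rho] Phi 2^-1.
- apply: bounded_closed_compact.
    by exists (2 * rho); split=> [|M /ltW rM b /= /le_trans]; [exact: num_real|exact].
  have := @preimage_closed _ R (fun b : 'rV[R]_l => `|b|) [set x | x <= 2 * rho].
  by apply => [b _|]; [exact: norm_continuous|exact: closed_le].
- by exists 0.
- by [].
- by rewrite invf_lt1// ltr1n.
- move=> /= br; rewrite -[Phi b](subrK (Phi 0)) (le_trans (ler_normD _ _))//.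
  have := PhiL _ _ br n0; rewrite subr0 Phi0 -/rho.
  by lra.
- exact: PhiL.
exists (z + b *m B).
  apply/esym/eqP; rewrite -subr_eq0; apply/eqP.
  by have := congr1 (fun u => u - b) bP; rewrite /Phi addrAC !subrr add0r.
by rewrite addrAC subrr add0r (le_trans (Bc b))// -mulrA mulrCA ler_wpM2l// ltW.
Qed.

End LinearOpenness.

(** * Normals of a set reduced to a cone *)

Lemma le0_small (R : realType) (x c : R) :
  (forall e, 0 < e -> e <= 1 -> x <= e * c) -> x <= 0.
Proof.
move=> xe; rewrite leNgt; apply/negP => x0.
have c0 : 0 < c by have := xe 1 ltr01 (lexx 1); lra.
pose e := Num.min 1 (x / (2 * c)).
have e0 : 0 < e by rewrite lt_min ltr01 divr_gt0// mulr_gt0.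
have ec : e <= x / (2 * c) by rewrite ge_min lexx orbT.
have := xe e e0; rewrite ge_min lexx => /(_ erefl).
have : e * c <= x / (2 * c) * c by rewrite ler_wpM2r// ltW.
have -> : x / (2 * c) * c = x / 2 by field; rewrite gt_eqF.
by lra.
Qed.

Lemma derive_expansion (R : realType) (V W : normedModType R) (F : V -> W) z a d :
  is_derive z a F d -> forall e : R, 0 < e -> exists2 r : R, 0 < r &
    forall s, 0 < s -> s < r -> `|F (z + s *: a) - F z - s *: d| <= e * s.
Proof.
move=> [dF dFd] e e0.
have /cvgrPdist_le/(_ e e0) :
    (fun s => s^-1 *: ((F \o shift z) (s *: a) - F z)) @ 0^' --> d.
  by rewrite -dFd.
rewrite -nbhs_nearE nbhs_simpl /= => /nbhs_ballP[r /= r0 rP]; exists r => // s s0 sr.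
have := rP s; rewrite /= /ball /= sub0r normrN gtr0_norm// => /(_ sr).
rewrite /within /= => /(_ (lt0r_neq0 s0)) => H.
have -> : F (z + s *: a) - F z - s *: d =
    - (s *: (d - s^-1 *: (F (s *: a + z) - F z))).
  by rewrite scalerBr scalerA divff ?gt_eqF// scale1r opprB (addrC z).
by rewrite normrN normrZ gtr0_norm// mulrC ler_wpM2r// ltW.
Qed.

Lemma inner_mulmx (R : realType) m n (x : 'rV[R]_m) (y : 'rV[R]_n) (M : 'M[R]_(m, n)) :
  inner (x *m M) y = inner x (y *m M^T).
Proof.
rewrite /inner; under eq_bigr do rewrite mxE mulr_suml.
rewrite exchange_big /=; apply: eq_bigr => i _; rewrite mxE mulr_sumr.
by apply: eq_bigr => j _; rewrite mxE mulrAC mulrA.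
Qed.

Lemma inner_inj (R : realType) n (x y : 'rV[R]_n) :
  (forall z, inner x z = inner y z) -> x = y.
Proof.
move=> xy; apply/eqP; rewrite -subr_eq0; apply/negPn/negP => /inner_gt0.
by rewrite [X in 0 < X]innerBl xy subrr ltxx.
Qed.

Lemma norm_trmx_le (R : realType) m n (M : 'M[R]_(m, n)) : `|M^T| <= `|M|.
Proof. by apply: norm_le_entries => // i j; rewrite mxE norm_entry_le. Qed.

(** A row u in the kernel satisfies u = - u *m (M - 1), hence
    |u| <= |u| / 2. *)
Lemma unitmx_near1 (R : realType) l (M : 'M[R]_l) :
  l%:R * `|M - 1%:M| <= 2^-1 -> M \in unitmx.
Proof.
move=> M1; rewrite -row_free_unit; apply: inj_row_free => u uM0.
have uE : u = - (u *m (M - 1%:M)) by rewrite mulmxBr uM0 mulmx1 sub0r opprK.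
have : `|u| <= 2^-1 * `|u|.
  rewrite {1}uE normrN (le_trans (norm_mulmx_le _ _))// mulrCA mulrC.
  by rewrite ler_wpM2r.
move=> u2; apply/eqP; rewrite -normr_le0; lra.
Qed.

(** The normal cone of convex analysis. *)
Definition normal_cone (R : realType) m (Theta : set 'rV[R]_m) (z : 'rV[R]_m) :=
  [set xi | forall y, Theta y -> inner xi (y - z) <= 0].

Section Reduction.
Context {R : realType} {m l : nat} (Theta : set 'rV[R]_m) (K : set 'rV[R]_l).
Context (h : 'rV[R]_m -> 'rV[R]_l) (J : 'rV[R]_m -> 'M[R]_(m, l)).
Context (B : 'M[R]_(l, m)) (z0 : 'rV[R]_m) (r c : R).
Hypothesis r_gt0 : 0 < r.
Hypothesis c_gt0 : 0 < c.
Hypothesis convexTheta : convex_set Theta.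
Hypothesis convexK : convex_set K.
Hypothesis ThetaE : forall z, `|z - z0| < r -> (Theta z <-> K (h z)).
Hypothesis dh : forall z, `|z - z0| < r -> forall a, is_derive z a h (a *m J z).
Hypothesis openh : forall z y, `|z - z0| < r -> `|y - h z| < r ->
  exists2 z', h z' = y & `|z' - z| <= c * `|y - h z|.
Hypothesis BJ : forall z, `|z - z0| < r -> l%:R * `|B *m J z - 1%:M| <= 2^-1.

Lemma norm_line_lt (z a : 'rV[R]_m) (e : R) : `|z - z0| < e ->
  exists2 d : R, 0 < d & forall s, 0 < s -> s < d -> `|z + s *: a - z0| < e.
Proof.
move=> ze; have a0 : 0 < `|a| + 1 by rewrite ltr_wpDl.
exists ((e - `|z - z0|) / (`|a| + 1)); first by rewrite divr_gt0// subr_gt0.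
move=> s s0; rewrite ltr_pdivlMr// => sd.
rewrite addrAC (le_lt_trans (ler_normD _ _))// normrZ gtr0_norm//; nra.
Qed.

(** Segments from z to y stay in Theta, so h maps their initial parts into K;
    the inequality is the derivative at z of lam along h. *)
Lemma normal_cone_pullback z (lam : 'rV[R]_l) : `|z - z0| < r -> Theta z ->
  (forall y, K y -> inner lam (y - h z) <= 0) ->
  normal_cone Theta z (lam *m (J z)^T).
Proof.
move=> zr Tz lamK y Ty; rewrite inner_mulmx trmxK.
apply: (@le0_small _ _ (l%:R * `|lam|)) => e e0 _.
have [d1 d1_gt0 exp] := derive_expansion (dh zr (y - z)) e0.
have [d2 d2_gt0 near] := norm_line_lt (y - z) zr.
pose s := Num.min 1 (Num.min d1 d2) / 2.
have [s0 s1 sd1 sd2] : [/\ 0 < s, s <= 1, s < d1 & s < d2].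
  have : 0 < Num.min 1 (Num.min d1 d2) by rewrite !lt_min ltr01 d1_gt0.
  have : Num.min 1 (Num.min d1 d2) <= 1 by rewrite ge_min lexx.
  have : Num.min 1 (Num.min d1 d2) <= d1 by rewrite !ge_min lexx !orbT.
  have : Num.min 1 (Num.min d1 d2) <= d2 by rewrite !ge_min lexx !orbT.
  by rewrite /s; split; lra.
have Ts : Theta (z + s *: (y - z)).
  have -> : z + s *: (y - z) = s *: y + (1 - s) *: z.
    by apply/rowP => i; rewrite !mxE; ring.
  by apply: convex_setP => //; exact: ltW.
have Ks := lamK _ ((ThetaE (near s s0 sd2)).1 Ts).
have := inner_le lam (- (h (z + s *: (y - z)) - h z - s *: ((y - z) *m J z))).
rewrite normrN opprB innerBr innerZr => H.
have : l%:R * (`|lam| * `|h (z + s *: (y - z)) - h z - s *: ((y - z) *m J z)|) <=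
    l%:R * (`|lam| * (e * s)) by rewrite !ler_wpM2l// exp.
move: Ks H; set q := inner lam (h _ - _); set p := inner lam (_ *m _).
by move=> q0 pq ue; rewrite -(ler_pM2l s0); lra.
Qed.

(** Since h z + s (y - h z) is in K for s <= 1, openness gives points of Theta
    at distance o(s) from z + s zeta; the normal xi is nonpositive along them,
    hence along zeta. *)
Lemma normal_cone_feasible z xi zeta y : `|z - z0| < r -> Theta z ->
  normal_cone Theta z xi -> K y -> zeta *m J z = y - h z -> inner xi zeta <= 0.
Proof.
move=> zr Tz Nxi Ky zy; apply: (@le0_small _ _ (m%:R * `|xi| * c)) => e0 e0_gt0 _.
pose e := Num.min e0 1.
have e_gt0 : 0 < e by rewrite lt_min e0_gt0 ltr01.
have [d1 d1_gt0 exp] := derive_expansion (dh zr zeta) e_gt0.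
have zr2 : `|z - z0| < (`|z - z0| + r) / 2 by lra.
have [d2 d2_gt0 near] := norm_line_lt zeta zr2.
pose d3 := (r - `|z - z0|) / (2 * c).
have d3_gt0 : 0 < d3 by rewrite divr_gt0 ?subr_gt0// mulr_gt0.
pose s := Num.min (Num.min 1 r) (Num.min (Num.min d1 d2) d3) / 2.
have [s0 s1 sr sd1 [sd2 sd3]] : [/\ 0 < s, s <= 1, s < r, s < d1 & s < d2 /\ s < d3].
  have : 0 < s by rewrite divr_gt0// !lt_min ltr01 r_gt0 d1_gt0 d2_gt0 d3_gt0.
  have : 2 * s <= 1 by rewrite mulrC divfK// !ge_min lexx ?orbT.
  have : 2 * s <= r by rewrite mulrC divfK// !ge_min lexx ?orbT.
  have : 2 * s <= d1 by rewrite mulrC divfK// !ge_min lexx ?orbT.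
  have : 2 * s <= d2 by rewrite mulrC divfK// !ge_min lexx ?orbT.
  have : 2 * s <= d3 by rewrite mulrC divfK// !ge_min lexx ?orbT.
  by split; [lra..|split; lra].
have zsr := near s s0 sd2.
have zsr' : `|z + s *: zeta - z0| < r by lra.
have Kys : K (s *: y + (1 - s) *: h z).
  by apply: convex_setP => //; [exact: ltW|exact/ThetaE].
have ys : `|s *: y + (1 - s) *: h z - h (z + s *: zeta)| <= e * s.
  rewrite (_ : _ - _ = - (h (z + s *: zeta) - h z - s *: (zeta *m J z))).
    by rewrite normrN exp.
  by rewrite zy; apply/rowP => i; rewrite !mxE; ring.
have es : e * s <= s by rewrite ger_pMl// ge_min lexx orbT.
have [z' z'y z's] := openh zsr' (le_lt_trans ys (le_lt_trans es sr)).
have z's2 : `|z' - (z + s *: zeta)| <= c * (e * s).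
  by apply: le_trans z's _; rewrite ler_wpM2l// ltW.
have Tz' : Theta z'.
  apply/ThetaE; last by rewrite z'y.
  rewrite -[z' - z0](subrKA (z + s *: zeta)) (le_lt_trans (ler_normD _ _))//.
  have : c * (e * s) <= c * s by rewrite ler_wpM2l// ltW.
  by move: sd3; rewrite /d3 ltr_pdivlMr ?mulr_gt0//; lra.
have := Nxi _ Tz'; rewrite -[z' - z](subrKA (z + s *: zeta)) innerDr.
rewrite [z + _ - z]addrAC subrr add0r innerZr.
have := inner_le xi (- (z' - (z + s *: zeta))); rewrite innerNr normrN.
have : m%:R * (`|xi| * `|z' - (z + s *: zeta)|) <= m%:R * (`|xi| * (c * (e * s))).
  by rewrite !ler_wpM2l.
have : m%:R * (`|xi| * (c * (e * s))) <= m%:R * (`|xi| * (c * (e0 * s))).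
  by rewrite !ler_wpM2l ?(ltW c_gt0)// ler_wpM2r ?(ltW s0)// ge_min lexx.
move: (inner xi (z' - _)) (inner xi zeta) => p q h1 h2 h3 h4.
rewrite -(ler_pM2l s0); lra.
Qed.

(** For a matrix C with C *m J z = 1, the multiplier is xi *m C^T.  It represents
    xi because xi vanishes on the kernel of J z, and it is normal to K because
    (y - h z) *m C is a direction as in normal_cone_feasible.  The bound comes
    from lam = xi *m B^T - lam *m (B *m J z - 1)^T, where the last term has norm
    at most |lam| / 2. *)
Lemma multiplier z xi : `|z - z0| < r -> Theta z -> normal_cone Theta z xi ->
  exists lam : 'rV[R]_l, [/\ lam *m (J z)^T = xi,
    forall y, K y -> inner lam (y - h z) <= 0 &
    `|lam| <= 2 * m%:R * `|B| * `|xi|].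
Proof.
move=> zr Tz Nxi; have Kz : K (h z) by exact/ThetaE.
set M := B *m J z; have Mu : M \in unitmx by exact/unitmx_near1/BJ.
pose C := invmx M *m B; have CJ : C *m J z = 1%:M by rewrite -mulmxA mulVmx.
have ker zeta : zeta *m J z = 0 -> inner xi zeta = 0.
  move=> zJ; apply/eqP; rewrite eq_le; apply/andP; split.
    by apply: (normal_cone_feasible zr Tz Nxi Kz); rewrite zJ subrr.
  rewrite -oppr_le0 -innerNr; apply: (normal_cone_feasible zr Tz Nxi Kz).
  by rewrite mulNmx zJ subrr oppr0.
exists (xi *m C^T); split.
- apply: inner_inj => zeta; rewrite !inner_mulmx !trmxK.
  apply/eqP; rewrite -subr_eq0 -innerBr ker//.
  by rewrite mulmxBl -(mulmxA _ C) CJ mulmx1 subrr.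
- move=> y Ky; rewrite inner_mulmx trmxK.
  by apply: (normal_cone_feasible zr Tz Nxi Ky); rewrite -(mulmxA _ C) CJ mulmx1.
- set lam := _ *m _.
  have lamE : lam = xi *m B^T - lam *m (M - 1%:M)^T.
    rewrite linearB /= trmx1 mulmxBr mulmx1 opprB addrC -mulmxA -trmx_mul.
    by rewrite mulmxA mulmxV// mul1mx subrK.
  have h1 : `|lam| <= m%:R * (`|xi| * `|B|) + 2^-1 * `|lam|.
    rewrite {1}lamE (le_trans (ler_normB _ _))// lerD//.
      by rewrite (le_trans (norm_mulmx_le _ _))// !ler_wpM2l// norm_trmx_le.
    rewrite (le_trans (norm_mulmx_le _ _))// mulrCA mulrC ler_wpM2r//.
    by apply: le_trans (BJ zr); rewrite ler_wpM2l// norm_trmx_le.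
  by lra.
Qed.

(** The constant M is uniform in z and in the precision e: the base point moves
    by at most (|zeta| + 1) t whatever e is.  The points z' are on the level set
    of h through z, so that the multiplier of xi at z remains one at z'. *)
Lemma normal_transport (L : R) zeta : 0 <= L ->
  (forall z z', `|z - z0| < r -> `|z' - z0| < r ->
    `|J z - J z'| <= L * `|z - z'|) ->
  (forall e : R, 0 < e -> exists2 rho : R, 0 < rho & forall z1 z2,
    `|z1 - z0| < rho -> `|z2 - z0| < rho ->
    `|h z1 - h z2 - (z1 - z2) *m J z0| <= e * `|z1 - z2|) ->
  zeta *m J z0 = 0 ->
  exists2 M : R, 0 <= M & forall e : R, 0 < e -> e <= 1 ->
  exists2 rho : R, 0 < rho & forall z xi, `|z - z0| < rho -> Theta z ->
    normal_cone Theta z xi -> exists2 d : R, 0 < d & forall t, 0 < t -> t < d ->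
    exists z' xi', [/\ Theta z', normal_cone Theta z' xi',
      `|z' - z - t *: zeta| <= e * t & `|xi' - xi| <= M * `|xi| * t].
Proof.
move=> L0 Jlip stricth zJ.
exists (l%:R * (2 * m%:R * `|B|) * L * (`|zeta| + 1)).
  by rewrite !mulr_ge0// addr_ge0.
move=> e e0 e1; have zeta1 : 0 < `|zeta| + 1 by rewrite ltr_wpDl.
pose e' := e / (c * (`|zeta| + 1)).
have e'0 : 0 < e' by rewrite divr_gt0// mulr_gt0.
have e'E : c * (e' * (`|zeta| + 1)) = e by rewrite /e'; field; rewrite !gt_eqF.
clearbody e'.
have [rho1 rho1_gt0 strict] := stricth _ e'0.
exists (Num.min rho1 r); first by rewrite lt_min rho1_gt0.
move=> z xi zrho Tz Nxi.
have zr : `|z - z0| < r by move: zrho; rewrite lt_min => /andP[].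
have zrho1 : `|z - z0| < rho1 by move: zrho; rewrite lt_min => /andP[].
have [lam [lamE lamK lamB]] := multiplier zr Tz Nxi.
have [d1 d1_gt0 near] := norm_line_lt zeta zrho.
exists (Num.min d1 (Num.min ((r - `|z - z0|) / (`|zeta| + 1)) (r * c))).
  by rewrite !lt_min d1_gt0 divr_gt0 ?subr_gt0 ?mulr_gt0.
move=> t t0; rewrite !lt_min => /and3P[td1 td2 td3].
have := near t t0 td1; rewrite lt_min => /andP[ztrho1 ztr].
have ht : `|h z - h (z + t *: zeta)| <= e' * (t * `|zeta|).
  have := strict _ _ ztrho1 zrho1; rewrite [z + _ - z]addrAC subrr add0r.
  by rewrite -scalemxAl zJ scaler0 subr0 normrZ gtr0_norm// distrC.
have cht : c * (e' * (t * `|zeta|)) <= e * t.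
  have : 0 <= c * e' * t by do !apply: mulr_ge0; exact: ltW.
  by move=> cet; rewrite -[in leRHS]e'E; lra.
have [|z' z'E z't] := openh (y := h z) ztr.
  apply: le_lt_trans ht _; rewrite -(ltr_pM2l c_gt0) (le_lt_trans cht)//.
  by rewrite (mulrC c); apply: le_lt_trans td3; rewrite ger_pMl.
have z'et : `|z' - z - t *: zeta| <= e * t.
  rewrite -addrA -opprD (le_trans z't)// (le_trans _ cht)//.
  by rewrite ler_wpM2l// ltW.
have z'z : `|z' - z| <= (`|zeta| + 1) * t.
  rewrite -[z' - z](subrK (t *: zeta)) (le_trans (ler_normD _ _))//.
  have : e * t <= 1 * t by rewrite ler_wpM2r// ltW.
  by rewrite normrZ gtr0_norm//; lra.
have z'r : `|z' - z0| < r.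
  rewrite -[z' - z0](subrKA z) (le_lt_trans (ler_normD _ _))//.
  by move: td2; rewrite ltr_pdivlMr//; lra.
have Tz' : Theta z' by apply/(ThetaE z'r); rewrite z'E; apply/(ThetaE zr).
exists z', (lam *m (J z')^T); split=> //.
  by apply: normal_cone_pullback => //; rewrite z'E.
rewrite -lamE -mulmxBr -linearB /= (le_trans (norm_mulmx_le _ _))//.
have JJ : `|(J z' - J z)^T| <= L * ((`|zeta| + 1) * t).
  rewrite (le_trans (norm_trmx_le _))// (le_trans (Jlip _ _ z'r zr))//.
  by rewrite ler_wpM2l.
have : `|lam| * `|(J z' - J z)^T| <=
    (2 * m%:R * `|B| * `|xi|) * (L * ((`|zeta| + 1) * t)) by rewrite ler_pM.
rewrite lamE => H; have : l%:R * (`|lam| * `|(J z' - J z)^T|) <=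
    l%:R * ((2 * m%:R * `|B| * `|xi|) * (L * ((`|zeta| + 1) * t))).
  by rewrite ler_wpM2l.
by lra.
Qed.

End Reduction.

(** * Normals of the epigraph and subgradients *)

Lemma epi_pointB (R : realType) n (v v' : 'rV[R]_n) (b b' : R) :
  row_mx v (const_mx b : 'rV_1) - row_mx v' (const_mx b') =
  row_mx (v - v') (const_mx (b - b')).
Proof.
rewrite opp_row_mx add_row_mx; congr row_mx.
by apply/rowP => i; rewrite !mxE.
Qed.

Section EpigraphNormals.
Context {R : realType} {n : nat} (f : 'rV[R]_n -> \bar R).
Implicit Types (x v d : 'rV[R]_n) (z xi : 'rV[R]_(n + 1)).

Lemma normal_cone_epiE z xi : normal_cone (epi f) z xi ->
  forall y (b : R), (f y <= b%:E)%E ->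
  inner (lsubmx xi) (y - lsubmx z) + rsubmx xi 0 0 * (b - rsubmx z 0 0) <= 0.
Proof.
move=> Nxi y b /epi_row_mx/Nxi.
rewrite [z in _ - z]row_mx_epi epi_pointB.
by rewrite [xi in inner xi _]row_mx_epi inner_row_mx inner_const_mx1.
Qed.

Lemma subdiff_normal_cone v x : subdiff f v x ->
  normal_cone (epi f) (row_mx v (const_mx (fine (f v)))) (row_mx x (const_mx (-1))).
Proof.
move=> [fv sub] y; rewrite (row_mx_epi y) => /epi_row_mx yb.
rewrite epi_pointB inner_row_mx inner_const_mx1.
have := le_trans (sub _) yb; move/fineK: fv => <-; rewrite -EFinD lee_fin /=.
by lra.
Qed.

(** A normal with negative last component can only occur on the graph of f,
    and scaling that component to - 1 turns it into a subgradient. *)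
Lemma normal_cone_subdiff z xi : epi f z -> normal_cone (epi f) z xi ->
  rsubmx xi 0 0 < 0 -> subdiff f (lsubmx z) ((- rsubmx xi 0 0)^-1 *: lsubmx xi).
Proof.
move=> ez /normal_cone_epiE Nxi; move: ez; rewrite /epi /=.
move: (lsubmx xi) (rsubmx xi 0 0) (lsubmx z) (rsubmx z 0 0) Nxi.
move=> a s v zl Nxi vz s0; have sN : 0 < - s by rewrite oppr_gt0.
have low b : (f v <= b%:E)%E -> zl <= b.
  move=> /Nxi; rewrite subrr inner0r add0r => sb; rewrite leNgt; apply/negP => bz.
  have : 0 < - s * (zl - b) by rewrite mulr_gt0// subr_gt0.
  by lra.
have fvE : f v = zl%:E.
  case fv : (f v) vz low => [b| |]// vz low.
    by congr EFin; apply/eqP; rewrite eq_le low// andbT -lee_fin.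
  by exfalso; have := low (zl - 1); rewrite leNye => /(_ erefl); lra.
split=> [|y]; first by rewrite fvE.
rewrite fvE -EFinD; case fy : (f y) => [b| |]; rewrite ?leey//.
  have := Nxi y b; rewrite fy lexx => /(_ erefl) H.
  rewrite lee_fin innerZl -(ler_pM2l sN) mulrDr mulrA divff ?gt_eqF// mul1r.
  by lra.
exfalso; have := Nxi y (zl + (inner a (y - v) - 1) / - s); rewrite fy leNye => /(_ erefl).
rewrite addrAC subrr add0r invrN mulrN mulrN mulrCA divff ?lt_eqF// mulr1.
by lra.
Qed.

End EpigraphNormals.

Section ParDual.
Context {R : realType} {n : nat}.
Implicit Types (C : set 'rV[R]_n) (w d : 'rV[R]_n).

(** The residual w - projv U w has a nonzero coordinate j; the functional is
    the j-th coordinate of the residual. *)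
Lemma separating_functional (U : {vspace 'rV[R]_n}) w : w \notin U ->
  exists d, (forall u, u \in U -> inner u d = 0) /\ inner w d != 0.
Proof.
move=> wU; have : w - projv U w != 0.
  by apply: contra wU; rewrite subr_eq0 => /eqP ->; exact: memv_proj.
case/rV0Pn => j wj.
pose phi (u : 'rV[R]_n) := (u - projv U u) 0 j.
pose d : 'rV[R]_n := \row_i phi (delta_mx 0 i).
have phiE u : phi u = inner u d.
  rewrite /phi [u in LHS]row_sum_delta linear_sum -sumrB summxE.
  apply: eq_bigr => i _; rewrite linearZ -scalerBr !mxE.
  by rewrite /phi !mxE.
exists d; split=> [u uU|]; last by rewrite -phiE.
by rewrite -phiE /phi projv_id// subrr mxE.
Qed.

(** Bi-orthogonality for the span of C - x. *)
Lemma par_dual C w : C !=set0 ->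
  (forall d, (forall x y, C x -> C y -> inner (y - x) d = 0) -> inner w d = 0) ->
  par C w.
Proof.
move=> [x Cx] wd; exists x => //.
set A := [set y - x | y in C].
pose P k := `[< exists2 X : seq 'rV[R]_n, (forall y, y \in X -> A y) & k = \dim <<X>> >].
have P0 : exists k, P k.
  by exists (\dim <<[::] : seq 'rV[R]_n>>); apply/asboolP; exists [::].
have Pn k : P k -> (k <= \dim (fullv : {vspace 'rV[R]_n}))%N.
  by move=> /asboolP[X _ ->]; apply/dimvS/subvf.
case: (ex_maxnP P0 Pn) => k /asboolP[X XA ->] Xmax.
(* a span of maximal dimension among finite subfamilies absorbs all of C - x *)
have AX y : A y -> y \in <<X>>%VS.
  move=> Ay; have XyX : (<<X>> <= <<y :: X>>)%VS by rewrite span_cons addvSr.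
  have : (\dim <<y :: X>> <= \dim <<X>>)%N.
    apply: Xmax; apply/asboolP; exists (y :: X) => // u.
    by rewrite inE => /orP[/eqP ->|/XA].
  rewrite (geq_leqif (dimv_leqif_sup XyX)) => /subvP; apply.
  by apply: memv_span; rewrite mem_head.
exists X => //; apply: contrapT => /negP/separating_functional[d [dX]].
move=> /eqP; apply; apply: wd => y y' Cy Cy'.
have -> : y' - y = (y' - x) - (y - x) by rewrite opprB addrA subrK.
by rewrite innerBl !dX ?subrr//; apply: AX; [exists y|exists y'].
Qed.

End ParDual.

(** * Motions in the graph of the subdifferential *)

Section GraphTransport.
Context {R : realType} {n : nat}.
Implicit Types (x v w d : 'rV[R]_n).

Lemma norm_const_mx1 (a : R) : `|const_mx a : 'rV[R]_1| <= `|a|.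
Proof. by apply: norm_le_entries => // i j; rewrite mxE. Qed.

(** Lifts (x, v) to the normal (x, - 1) of the epigraph at (v, f v), which is
    near the lift of (x0, v0) because subgradients bound the variation of f,
    and normalises the transported normal, whose last component stays within
    1/2 of - 1 for small t. *)
Lemma subdiff_transport (f : 'rV[R]_n -> \bar R) x0 v0
    (zeta : 'rV[R]_(n + 1)) :
  subdiff f v0 x0 ->
  (exists2 M : R, 0 <= M & forall e : R, 0 < e -> e <= 1 ->
    exists2 rho : R, 0 < rho & forall z xi,
      `|z - row_mx v0 (const_mx (fine (f v0)))| < rho -> epi f z ->
      normal_cone (epi f) z xi -> exists2 d : R, 0 < d & forall t, 0 < t -> t < d ->
      exists z' xi', [/\ epi f z', normal_cone (epi f) z' xi',
        `|z' - z - t *: zeta| <= e * t & `|xi' - xi| <= M * `|xi| * t]) ->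
  exists2 M : R, 0 <= M & forall e : R, 0 < e -> e <= 1 ->
    exists2 rho : R, 0 < rho & forall x v, `|x - x0| < rho -> `|v - v0| < rho ->
      subdiff f v x -> exists2 d : R, 0 < d & forall t, 0 < t -> t < d ->
      exists x' v', [/\ subdiff f v' x', `|x' - x| <= M * t &
        `|v' - v - t *: lsubmx zeta| <= e * t].
Proof.
move=> sub0 [M M0 trans]; pose X := `|x0| + 2.
have X0 : 0 < X by rewrite ltr_wpDl.
exists (2 * (M * X) * (1 + X)); first by rewrite !mulr_ge0 ?addr_ge0// ltW.
move=> e e0 e1; have [rho rho0 tr] := trans e e0 e1.
pose c := 1 + n%:R * X; have c0 : 0 < c by rewrite ltr_pwDl// mulr_ge0// ltW.
exists (Num.min 1 (rho / c)); first by rewrite lt_min ltr01 divr_gt0.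
move=> x v; rewrite !lt_min => /andP[xx1 _] /andP[_]; rewrite ltr_pdivlMr// => vrho sub.
have xX : `|x| + 1 <= X.
  have := ler_normD (x - x0) x0; rewrite subrK /X; lra.
pose z : 'rV[R]_(n + 1) := row_mx v (const_mx (fine (f v))).
have zz0 : `|z - row_mx v0 (const_mx (fine (f v0)))| < rho.
  rewrite /z epi_pointB.
  rewrite (le_lt_trans (norm_row_mx_le _ _))//; apply: le_lt_trans vrho.
  rewrite /c mulrDr mulr1 lerD2l (le_trans (norm_const_mx1 _))//.
  case: sub0 sub => fv0 s0 [fv s1]; have := s0 v; have := s1 v0.
  move/fineK: fv0 => <-; move/fineK: fv => <-; rewrite -!EFinD !lee_fin /= => h1 h2.
  have h3 := norm_inner_le x (v0 - v); have h4 := norm_inner_le x0 (v - v0).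
  rewrite distrC in h3.
  have h5 : n%:R * (`|x| * `|v - v0|) <= `|v - v0| * (n%:R * X).
    rewrite [leRHS]mulrC -mulrA ler_wpM2l// ler_wpM2r//; lra.
  have h6 : n%:R * (`|x0| * `|v - v0|) <= `|v - v0| * (n%:R * X).
    rewrite [leRHS]mulrC -mulrA ler_wpM2l// ler_wpM2r// /X; lra.
  move: h3 h4; rewrite !ler_norml => /andP[h31 h32] /andP[h41 h42].
  by apply/andP; split; lra.
have ez : epi f z by apply/epi_row_mx; case: sub => /fineK ->.
have [d d0 {}tr] := tr _ _ zz0 ez (subdiff_normal_cone sub).
have MX0 : 0 <= M * X by rewrite mulr_ge0// ltW.
exists (Num.min d (2 * (M * X + 1))^-1).
  by rewrite lt_min d0 invr_gt0 mulr_gt0// ltr_wpDl.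
move=> t t0; rewrite lt_min => /andP[td tM].
have [z' [xi' [ez' Nxi' z'z xi'xi]]] := tr t t0 td.
set xi := row_mx x _ in xi'xi.
have xiX : `|xi| <= X.
  rewrite (le_trans (norm_row_mx_le _ _))// (le_trans _ xX)// lerD2l.
  by rewrite (le_trans (norm_const_mx1 _))// normrN normr1.
have {}xi'xi : `|xi' - xi| <= M * X * t.
  by apply: le_trans xi'xi _; rewrite ler_wpM2r ?(ltW t0)// ler_wpM2l.
have small : M * X * t <= 2^-1.
  have : t * (2 * (M * X + 1)) < 1 by rewrite -ltr_pdivlMr ?mul1r// mulr_gt0// ltr_wpDl.
  by lra.
pose s := - rsubmx xi' 0 0.
have s1 : `|1 - s| <= M * X * t.
  apply: le_trans xi'xi; apply: le_trans (norm_rsubmx_le _).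
  suff -> : 1 - s = rsubmx (xi' - xi) 0 0 by exact: norm_entry_le.
  by rewrite linearB /= row_mxKr entryB [const_mx _ _ _]mxE /s !opprK addrC.
have s2 : 2^-1 <= s.
  by have := le_trans s1 small; rewrite ler_norml => /andP[_]; lra.
have s0 : 0 < s by lra.
exists (s^-1 *: lsubmx xi'), (lsubmx z'); split.
- by apply: normal_cone_subdiff => //; rewrite -oppr_gt0.
- have -> : s^-1 *: lsubmx xi' - x = s^-1 *: (lsubmx (xi' - xi) + (1 - s) *: x).
    rewrite linearB /= row_mxKl; apply/rowP => i; rewrite !mxE; field.
    by rewrite gt_eqF.
  rewrite normrZ gtr0_norm ?invr_gt0// ler_pdivrMl//.
  rewrite (le_trans (ler_normD _ _))// normrZ.
  have h1 : `|lsubmx (xi' - xi)| <= M * X * t.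
    exact: le_trans (norm_lsubmx_le _) xi'xi.
  have h2 : `|1 - s| * `|x| <= M * X * t * X.
    by rewrite ler_pM//; move: xX (normr_ge0 x); lra.
  have h3 : 2^-1 * (2 * (M * X) * (1 + X) * t) <= s * (2 * (M * X) * (1 + X) * t).
    by rewrite ler_wpM2r// !mulr_ge0 ?addr_ge0// ltW.
  by apply: le_trans (lerD h1 h2) (le_trans _ h3); lra.
- apply: le_trans z'z; apply: le_trans (norm_lsubmx_le _).
  by rewrite linearB /= linearB /= [lsubmx (t *: _)]linearZ /= row_mxKl.
Qed.

(** Take a regular normal (p, q) near (0, - w) at a point (x, v) near (x0, v0).
    Along the motion, inner p (x' - x) + inner q (v' - v) is at most o(t); the
    first term is a small multiple of t, and the second is - t * inner w d up to
    a small multiple of t. *)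
Lemma limiting_normal_transport (g : 'rV[R]_n -> \bar R) x0 v0 w d :
  ker_gen_hessian g x0 v0 w ->
  (exists2 M : R, 0 <= M & forall e : R, 0 < e -> e <= 1 ->
    exists2 rho : R, 0 < rho & forall x v, `|x - x0| < rho -> `|v - v0| < rho ->
      subdiff g x v -> exists2 d0 : R, 0 < d0 & forall t, 0 < t -> t < d0 ->
      exists x' v', [/\ subdiff g x' v', `|x' - x| <= M * t &
        `|v' - v - t *: d| <= e * t]) ->
  - inner w d <= 0.
Proof.
move=> [zk [qk [reg zk_cvg qk_cvg]]] [M M0 trans].
apply: (@le0_small _ _
  ((M + `|d| + 1) + n%:R * (`|w| + 1) + n%:R * M + n%:R * `|d|)) => e e0 e1.
have [rho rho0 {}trans] := trans e e0 e1.
have [k [zk_rho qk_e]] : exists k, `|zk k - row_mx x0 v0| < rho /\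
    `|qk k - row_mx 0 (- w)| < e.
  have H1 : \forall k \near \oo, `|zk k - row_mx x0 v0| < rho.
    exact: zk_cvg _ (near_dist_lt (row_mx x0 v0) rho0).
  have H2 : \forall k \near \oo, `|qk k - row_mx 0 (- w)| < e.
    exact: qk_cvg _ (near_dist_lt (row_mx 0 (- w)) e0).
  by have [k [? ?]] := filter_ex (filterI H1 H2); exists k.
have [gphk [_ /(_ e e0)/near_dist[r r0 regk]]] := reg k.
move: zk_rho qk_e gphk regk; move: (zk k) (qk k) => z q {reg zk_cvg qk_cvg zk qk k}.
move=> z_rho q_e; rewrite /gph_subdiff /= => gphz regz.
have [||d0 d0_gt0 {}trans] := trans (lsubmx z) (rsubmx z) _ _ gphz.
- apply: le_lt_trans z_rho; apply: le_trans (norm_lsubmx_le _).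
  by rewrite linearB /= row_mxKl.
- apply: le_lt_trans z_rho; apply: le_trans (norm_rsubmx_le _).
  by rewrite linearB /= row_mxKr.
pose c := M + `|d| + 1; have c0 : 0 < c by rewrite ltr_wpDl// addr_ge0.
pose t := Num.min d0 (r / c) / 2.
have m0 : 0 < Num.min d0 (r / c) by rewrite lt_min d0_gt0 divr_gt0.
have t0 : 0 < t by rewrite divr_gt0.
have tm : t < Num.min d0 (r / c) by rewrite /t; lra.
have td : t < d0 by apply: lt_le_trans tm _; rewrite ge_min lexx.
have tr : t * c < r.
  by rewrite -ltr_pdivlMr//; apply: lt_le_trans tm _; rewrite ge_min lexx orbT.
have [x' [v' [sub' x'x v'v]]] := trans t t0 td.
pose y := row_mx x' v'.
have v'vt : `|v' - rsubmx z| <= (`|d| + 1) * t.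
  rewrite -[v' - _](subrK (t *: d)) (le_trans (ler_normD _ _))//.
  have : e * t <= 1 * t by rewrite ler_wpM2r// ltW.
  by rewrite normrZ gtr0_norm//; lra.
have yz : y - z = row_mx (x' - lsubmx z) (v' - rsubmx z).
  by rewrite -[z in y - z]hsubmxK opp_row_mx add_row_mx.
have yzt : `|y - z| <= t * c.
  rewrite yz (le_trans (norm_row_mx_le _ _))// (le_trans (lerD x'x v'vt))//.
  by rewrite /c; lra.
have := regz y (le_lt_trans yzt tr); rewrite /y row_mxKl row_mxKr => /(_ sub').
rewrite -/y -[q in inner q _]hsubmxK {1}yz inner_row_mx => H.
have q1 : `|lsubmx q| <= e.
  apply: ltW; apply: le_lt_trans q_e; apply: le_trans (norm_lsubmx_le _).
  by rewrite linearB /= row_mxKl subr0.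
have q2 : `|rsubmx q + w| <= e.
  apply: ltW; apply: le_lt_trans q_e; apply: le_trans (norm_rsubmx_le _).
  by rewrite linearB /= row_mxKr opprK.
have h1 : - inner (lsubmx q) (x' - lsubmx z) <= n%:R * (e * (M * t)).
  rewrite -innerNr (le_trans (inner_le _ _))// ler_wpM2l// normrN.
  by rewrite ler_pM.
have q3 : `|rsubmx q| <= `|w| + 1.
  rewrite -[rsubmx q](addrK w) (le_trans (ler_normB _ _))//; lra.
have h2 : - inner (rsubmx q) (v' - rsubmx z - t *: d) <= n%:R * ((`|w| + 1) * (e * t)).
  rewrite -innerNr (le_trans (inner_le _ _))// ler_wpM2l// normrN.
  by rewrite ler_pM.
have h3 : - inner (rsubmx q + w) d <= n%:R * (e * `|d|).
  rewrite -innerNr (le_trans (inner_le _ _))// ler_wpM2l// normrN.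
  by rewrite ler_wpM2r.
have h4 : e * `|y - z| <= e * (t * c) by rewrite ler_wpM2l// ltW.
move: h2 h3; rewrite innerBr innerZr innerDl => h2 h3.
have h5 : t * inner (rsubmx q) d <= t * (e * c + n%:R * (`|w| + 1) * e + n%:R * e * M).
  by lra.
rewrite ler_pM2l// in h5; rewrite -/c; lra.
Qed.

End GraphTransport.

(** * The converse inclusion *)

(** Each of the finitely many derivatives along the coordinate directions is
    Lipschitz near z0 by locally_lipschitz; sums of the constants and of the
    inverse radii serve as uniform bounds. *)
Lemma jacobian_lipschitz (R : realType) m l (F : 'rV[R]_m -> 'rV[R]_l) z0 (r0 : R) :
  0 < r0 -> (forall z, `|z - z0| < r0 -> differentiable F z) ->
  (forall a, \forall z \near z0, differentiable ('D_a F) z) ->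
  (forall a b, {for z0, continuous ('D_b ('D_a F))}) ->
  exists (c r : R), [/\ 0 <= c, 0 < r & forall z z',
    `|z - z0| < r -> `|z' - z0| < r -> `|'J F z - 'J F z'| <= c * `|z - z'|].
Proof.
move=> r0_gt0 dF ddF cF.
have /choice[p pP] : forall i : 'I_m, exists q : R * R, [/\ 0 < q.1, 0 < q.2 &
    forall z z', `|z - z0| < q.2 -> `|z' - z0| < q.2 ->
    `|'D_(delta_mx 0 i) F z - 'D_(delta_mx 0 i) F z'| <= q.1 * `|z - z'|].
  move=> i.
  have [c [r [c0 r_gt0 H]]] := locally_lipschitz (ddF (delta_mx 0 i)) (cF (delta_mx 0 i)).
  by exists (c, r).
pose s := 1 + \sum_i (p i).2^-1.
have sp i : (p i).2^-1 <= s.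
  rewrite /s (bigD1 i)//= addrCA lerDl addr_ge0// sumr_ge0// => j _.
  by have [_ /ltW] := pP j; rewrite invr_ge0.
have s0 : 0 < s.
  by rewrite ltr_pwDl// sumr_ge0// => j _; have [_ /ltW] := pP j; rewrite invr_ge0.
exists (\sum_i (p i).1), (Num.min r0 s^-1); split.
- by apply: sumr_ge0 => i _; have [/ltW] := pP i.
- by rewrite lt_min r0_gt0 invr_gt0.
move=> z z'; rewrite !lt_min => /andP[zr0 zs] /andP[z'r0 z's].
have c0 : 0 <= \sum_i (p i).1 by apply: sumr_ge0 => i _; have [/ltW] := pP i.
apply: norm_le_entries => [|i j]; first by rewrite mulr_ge0.
have [pi1 pi2 lip] := pP i.
have sr : s^-1 <= (p i).2 by rewrite -[leRHS]invrK lef_pV2 ?posrE ?invr_gt0.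
have E : ('J F z - 'J F z') i j =
    ('D_(delta_mx 0 i) F z - 'D_(delta_mx 0 i) F z') 0 j.
  by rewrite [LHS]entryB [RHS]entryB; congr (_ - _); apply: jacobianE; apply: dF.
rewrite E (le_trans (norm_entry_le _ _ _))//.
rewrite (le_trans (lip _ _ (lt_le_trans zs sr) (lt_le_trans z's sr)))//.
rewrite ler_wpM2r// (bigD1 i)//= lerDl sumr_ge0// => k _.
by have [/ltW] := pP k.
Qed.

Lemma row_full_jacobian (R : realType) m l (F : 'rV[R]_m -> 'rV[R]_l) z0 :
  (forall y, exists x, 'd F z0 x = y) -> row_full ('J F z0).
Proof.
move=> surj; rewrite -sub1mx; apply/row_subP => i; apply/submxP.
have [x xE] := surj (row i 1%:M); exists x.
by rewrite -xE /jacobian mul_rV_lin1.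
Qed.

(** Collects the local data of a reduction: a radius on which the reduction
    describes Theta and h is differentiable with Jacobian J, together with the
    transport of normals along the kernel of J z0. *)
Lemma cone_reducible_transport (R : realType) m (Theta : set 'rV[R]_m) z0 :
  C2_cone_reducible_set Theta z0 ->
  exists (l : nat) (K : set 'rV[R]_l) (h : 'rV[R]_m -> 'rV[R]_l)
    (J : 'rV[R]_m -> 'M[R]_(m, l)) (r : R),
  [/\ pointed_closed_convex_cone K, h z0 = 0, 0 < r,
      forall z, `|z - z0| < r -> (Theta z <-> K (h z)) /\
        forall a, is_derive z a h (a *m J z) &
      forall zeta, zeta *m J z0 = 0 ->
  exists2 M : R, 0 <= M & forall e : R, 0 < e -> e <= 1 ->
  exists2 rho : R, 0 < rho & forall z xi, `|z - z0| < rho -> Theta z ->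
    normal_cone Theta z xi -> exists2 d : R, 0 < d & forall t, 0 < t -> t < d ->
    exists z' xi', [/\ Theta z', normal_cone Theta z' xi',
      `|z' - z - t *: zeta| <= e * t & `|xi' - xi| <= M * `|xi| * t]].
Proof.
move=> [_ cTheta _ [V [l [K [h [[oV Vz0] coneK C2h [hz0 surj] ThetaV]]]]]].
have nV : \forall z \near z0, V z by exact: open_nbhs_nbhs.
have [r0 r0_gt0 rV] := near_dist nV.
have ndh : \forall z \near z0, differentiable h z.
  by apply: filterS nV => z /C2h[].
have dh z : `|z - z0| < r0 -> differentiable h z by move=> /rV/C2h[].
have ch a : {for z0, continuous ('D_a h)}.
  by have [_ /(_ a)[/differentiable_continuous]] := C2h _ Vz0.
have nddh a : \forall z \near z0, differentiable ('D_a h) z.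
  by apply: filterS nV => z /C2h[_ /(_ a)[]].
have cch a b : {for z0, continuous ('D_b ('D_a h))}.
  by have [_ /(_ a)[_]] := C2h _ Vz0.
have [L [r1 [L0 r1_gt0 Jlip]]] := jacobian_lipschitz r0_gt0 dh nddh cch.
have BJ0 := mulVpmx (row_full_jacobian surj).
have [c [r2 [c0 r2_gt0 openh]]] := linear_openness ndh ch BJ0.
have strict := strict_differentiability ndh ch.
have [r3 r3_gt0 dJ] := jacobian_near ndh ch ltr01.
move: (jacobian h) BJ0 Jlip dJ strict => J; move: (pinvmx _) => B BJ0 Jlip dJ strict.
pose k := 2 * (l%:R * (m%:R * (`|B| * L))) + 1.
have k0 : 0 < k by rewrite ltr_wpDl// !mulr_ge0.
pose r := Num.min (Num.min r0 r1) (Num.min (Num.min r2 r3) k^-1).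
have r_gt0 : 0 < r by rewrite !lt_min r0_gt0 r1_gt0 r2_gt0 r3_gt0 invr_gt0.
have rr0 : r <= r0 by rewrite !ge_min lexx ?orbT.
have rr1 : r <= r1 by rewrite !ge_min lexx ?orbT.
have rr2 : r <= r2 by rewrite !ge_min lexx ?orbT.
have rr3 : r <= r3 by rewrite !ge_min lexx ?orbT.
have rk : r <= k^-1 by rewrite !ge_min lexx ?orbT.
have ThetaE z : `|z - z0| < r -> Theta z <-> K (h z).
  move=> zr; have Vz := rV _ (lt_le_trans zr rr0).
  have : (Theta `&` V) z <-> V z /\ K (h z) by rewrite ThetaV.
  move=> /= [H1 H2]; split=> [Tz|Kz].
    by case: (H1 (conj Tz Vz)).
  by case: (H2 (conj Vz Kz)).
have dhr z : `|z - z0| < r -> forall a, is_derive z a h (a *m J z).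
  by move=> zr; have [] := dJ _ (lt_le_trans zr rr3).
have BJ z : `|z - z0| < r -> l%:R * `|B *m J z - 1%:M| <= 2^-1.
  move=> zr; rewrite -BJ0 -mulmxBr.
  have h1 := norm_mulmx_le B (J z - J z0).
  have h2 : `|J z - J z0| <= L * `|z - z0|.
    by apply: Jlip; [exact: lt_le_trans zr rr1|rewrite subrr normr0].
  have h3 : `|z - z0| * k <= 1.
    by rewrite -ler_pdivlMr// mul1r (le_trans (ltW zr)).
  have h4 : l%:R * `|B *m (J z - J z0)| <= l%:R * (m%:R * (`|B| * (L * `|z - z0|))).
    by rewrite ler_wpM2l// (le_trans h1)// !ler_wpM2l.
  have := normr_ge0 (z - z0); rewrite /k in h3; lra.
exists l, K, h, J, r; split=> // [z zr|zeta zJ].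
  by split; [exact: ThetaE|exact: dhr].
have [_ cK _ _] := coneK.
apply: (@normal_transport _ _ _ Theta K h J B z0 r c r_gt0 c0 cTheta cK ThetaE dhr _ BJ
  L zeta L0 _ strict zJ).
  by move=> z y zr yr; apply: openh;
    [exact: lt_le_trans zr rr2|exact: lt_le_trans yr rr2].
by move=> z z' zr z'r; apply: Jlip;
  [exact: lt_le_trans zr rr1|exact: lt_le_trans z'r rr1].
Qed.

(** By pointedness it suffices that zeta *m J z0 be in K.  Otherwise a linear
    form separating it from K pulls back to a normal xi of the epigraph with
    inner xi zeta > 0, whereas the subgradients at v0, which are the normals
    (x, - 1), are orthogonal to zeta. *)
Lemma subdiff_polar_ker (R : realType) n l (f : 'rV[R]_n -> \bar R) x0 v0
    (K : set 'rV[R]_l) (h : 'rV[R]_(n + 1) -> 'rV[R]_l)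
    (J : 'rV[R]_(n + 1) -> 'M[R]_(n + 1, l)) (r : R) :
  let z0 := row_mx v0 (const_mx (fine (f v0))) in
  convex_set (epi f) -> subdiff f v0 x0 -> pointed_closed_convex_cone K ->
  h z0 = 0 -> 0 < r ->
  (forall z, `|z - z0| < r -> (epi f z <-> K (h z)) /\
     forall a, is_derive z a h (a *m J z)) ->
  forall zeta : 'rV[R]_(n + 1),
  (forall x, subdiff f v0 x -> inner (row_mx x (const_mx (-1))) zeta = 0) ->
  zeta *m J z0 = 0.
Proof.
move=> z0 cf sub0 [clK cK coneK ptK] hz0 r0 red.
have z0r : `|z0 - z0| < r by rewrite subrr normr0.
have ez0 : epi f z0 by apply/epi_row_mx; case: sub0 => /fineK ->.
have Kn0 : K !=set0 by exists (h z0); apply/(red _ z0r).1.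
suff inK zeta : (forall x, subdiff f v0 x ->
    inner (row_mx x (const_mx (-1))) zeta = 0) -> K (zeta *m J z0).
  move=> zeta zC; have KN : K (- zeta *m J z0).
    by apply: inK => x Cx; rewrite innerNr zC// oppr0.
  have : (K `&` [set - y | y in K]) (zeta *m J z0).
    split; first exact: inK.
    by exists (- zeta *m J z0) => //; rewrite mulNmx opprK.
  by rewrite ptK.
move=> zC; apply: contrapT => /(cone_separation clK cK Kn0 coneK)[a a0 aK].
have Nxi : normal_cone (epi f) z0 (a *m (J z0)^T).
  apply: (@normal_cone_pullback _ _ _ _ K h J z0 r) => // [z zr|z zr|y Ky].
  - exact: (red z zr).1.
  - exact: (red z zr).2.
  - by rewrite hz0 subr0; exact: aK.
set xi := a *m _ in Nxi; have xiz : 0 < inner xi zeta by rewrite inner_mulmx trmxK.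
(* a large multiple of the normal (x0, -1) tilts xi to a non-vertical normal *)
pose N := `|rsubmx xi 0 0| + 1.
pose xi' := xi + N *: row_mx x0 (const_mx (-1)).
have N0 : 0 <= N by rewrite addr_ge0.
have Nxi' : normal_cone (epi f) z0 xi'.
  move=> y ey; rewrite innerDl innerZl.
  have := Nxi y ey; have := mulr_ge0_le0 N0 (subdiff_normal_cone sub0 ey).
  by rewrite -/z0; lra.
have s0 : rsubmx xi' 0 0 < 0.
  rewrite /xi' linearD linearZ /= row_mxKr [X in X < 0]mxE.
  rewrite [X in _ + X < 0]mxE [X in _ + _ * X < 0]mxE /N.
  by have := ler_norm (rsubmx xi 0 0); lra.
have := normal_cone_subdiff ez0 Nxi' s0; rewrite row_mxKl => subx.
have xi'E : xi' = - rsubmx xi' 0 0 *: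
    row_mx ((- rsubmx xi' 0 0)^-1 *: lsubmx xi') (const_mx (-1)).
  rewrite [LHS]row_mx_epi scale_row_mx scalerA divff ?oppr_eq0 ?lt_eqF// scale1r.
  congr row_mx; apply/rowP => i.
  by rewrite [LHS]mxE [RHS]mxE [const_mx _ _ _]mxE mulrN1 opprK.
have : inner xi' zeta = 0 by rewrite xi'E innerZl (zC _ subx) mulr0.
rewrite [X in X = 0]innerDl [X in _ + X = 0]innerZl (zC _ sub0) mulr0 addr0 => xiz0.
by rewrite xiz0 ltxx in xiz.
Qed.

(** If d is orthogonal to the differences of subgradients of the conjugate at
    v0, then inner x d takes the same value for all of them, which is the last
    component of the vector zeta of the kernel to move along. *)
Lemma ker_sub_par (R : realType) (n : nat) (g : 'rV[R]_n -> \bar R) x0 v0 :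
  proper_fun g -> lower_semicontinuous g -> convex_efun g -> subdiff g x0 v0 ->
  C2_cone_reducible (fenchel g) v0 ->
  ker_gen_hessian g x0 v0 `<=` par (subdiff (fenchel g) v0).
Proof.
move=> pg lg cg gxv [_ red] w kerw.
have dualP x v : subdiff (fenchel g) v x <-> subdiff g x v by exact: subdiff_fenchel.
have sub0 : subdiff (fenchel g) v0 x0 by apply/dualP.
have [_ cepi _ _] := red.
have [l [K [h [J [r [coneK hz0 r0 redE trans]]]]]] := cone_reducible_transport red.
have half d : (forall x y, subdiff (fenchel g) v0 x -> subdiff (fenchel g) v0 y ->
    inner (y - x) d = 0) -> - inner w d <= 0.
  move=> dC; pose zeta : 'rV[R]_(n + 1) := row_mx d (const_mx (inner x0 d)).
  have zJ : zeta *m J (row_mx v0 (const_mx (fine (fenchel g v0)))) = 0.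
    apply: (subdiff_polar_ker cepi sub0 coneK hz0 r0 redE) => x Cx.
    rewrite inner_row_mx inner_const_mx1 mulN1r -innerBl.
    exact: dC.
  apply: (limiting_normal_transport kerw).
  have [M M0 T] := subdiff_transport sub0 (trans _ zJ).
  exists M => // e e0 e1; have [rho rho0 {}T] := T e e0 e1.
  exists rho => // x v xrho vrho /dualP sub.
  have [d0 d0_gt0 {}T] := T x v xrho vrho sub.
  exists d0 => // t t0 td; have [x' [v' [sub' x'x v'v]]] := T t t0 td.
  by exists x', v'; split=> //; [exact/dualP|move: v'v; rewrite row_mxKl].
apply: par_dual; first by exists x0.
move=> d dC; apply/eqP; rewrite eq_le -[X in _ && X]oppr_le0 half// andbT.
rewrite -[inner w d]opprK -innerNr half// => x y Cx Cy.
by rewrite innerNr dC// oppr0.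
Qed.

Theorem theorem4p6 (R : realType) (n : nat) (g : 'rV[R]_n -> \bar R)
    (xbar vbar : 'rV[R]_n) :
  proper_fun g -> lower_semicontinuous g -> convex_efun g ->
  subdiff g xbar vbar ->
  [/\ par (subdiff (fenchel g) vbar) `<=`
        ker_gen_hessian g xbar vbar `|`
        [set - w | w in ker_gen_hessian g xbar vbar],
      twice_epi_diff (fenchel g) vbar ->
        par (subdiff (fenchel g) vbar) `<=` ker_gen_hessian g xbar vbar
    & C2_cone_reducible (fenchel g) vbar ->
        par (subdiff (fenchel g) vbar) = ker_gen_hessian g xbar vbar].
Proof.
move=> pg lg cg gxv; have parker := par_sub_ker pg lg cg gxv.
split=> [w /parker|_|red]; [by left|exact: parker|].
by apply/seteqP; split; [exact: parker|exact: ker_sub_par].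
Qed.
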